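(* Let $T>0$, let $\mathcal D\subseteq\mathbb R^d$ be a convex domain or the closure of one, let $Y$ be the $\mathcal D$-valued diffusion $dY_t=\mu_Y(Y_t)dt+\sigma_Y(Y_t)dW_t$ with $Y_0\in\mathcal D$, let $f:\mathcal D\to\mathbb R$ and $u(t,y)=\mathbb E[f(Y_T^{t,y})]$, under the standing properties (a), (b), (c) listed in the context. For $N\in\mathbb N^*$ and $h=T/N$ let $(Y^h_n)_{n=0,\dots,N}$ be a Markov chain with values in $\mathcal D$ and $Y^h_0=Y_0$. Assume that this family of chains satisfies Assumptions $\mathcal H_1$ and $\mathcal H_2$ (stated in the context) and that $u\in C^4_{\mathrm{pol},T}(\mathcal D)$. Then there exist $\bar h>0$ and $C>0$ (independent of $h$) such that for every $h=T/N<\bar h$ $$\big|\mathbb E[f(Y^h_N)]-\mathbb E[f(Y_T)]\big|\le C\,T\,h .$$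
   Context: $\mathbb N^*=\mathbb N\setminus\{0\}$, $d\in\mathbb N^*$. For $l\in\mathbb N^d$: $|l|=\sum_j l_j$, $y^l=y_1^{l_1}\cdots y_d^{l_d}$, $\partial_y^l=\partial_{y_1}^{l_1}\cdots\partial_{y_d}^{l_d}$. $\|\cdot\|_p$ is the norm of $L^p(\Omega)$; $|\cdot|$ is the Euclidean norm (or the induced operator norm on matrices). $\star$ denotes transpose. $W$ is an $\ell$-dimensional standard Brownian motion and $a_Y=\sigma_Y\sigma_Y^\star$. $C^q(\mathcal D)$: functions $q$ times continuously differentiable on $\mathcal D$ (up to the boundary points contained in $\mathcal D$). $C^q_{\mathrm{pol},T}(\mathcal D)$: functions $v\in C^{\lfloor q/2\rfloor,q}([0,T)\times\mathcal D)$ for which there exist $C,a>0$ with $\sup_{t<T}|\partial_t^k\partial_y^l v(t,y)|\le C(1+|y|^a)$ for all $y\in\mathcal D$ and $2k+|l|\le q$. $Y^{t,y}$ denotes the solution of the SDE started at time $t$ from $y$. Standing properties: (a) $\mu_Y$ has polynomial growth; (b) for every $(t,y)\in[0,T]\times\mathcal D$ there is a unique weak solution $(Y^{t,y}_s)_{s\in[t,T]}$ of the SDE, and $\mathbb P(\forall s\in[t,T],\ Y_s^{t,y}\in\mathcal D)=1$; (c) $u$ solves (in the classical sense, in particular $u$ is continuous on $[0,T]\times\mathcal D$) $\partial_t u+\mathcal A u=0$ in $[0,T)\times\mathcal D$, $u(T,y)=f(y)$ in $\mathcal D$, where $\mathcal A=\frac12\mathrm{Tr}(a_YD_y^2)+\mu_Y\cdot\nabla_y$.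 Assumption $\mathcal H_1$: there exists $\bar h>0$ such that for every $h<\bar h$ and every $n=0,\dots,N-1$, $\mathbb E[Y^h_{n+1}-Y^h_n\mid Y^h_n]=\mu_Y(Y^h_n)h+f_h(Y^h_n)$, $\mathbb E[(Y^h_{n+1}-Y^h_n)(Y^h_{n+1}-Y^h_n)^\star\mid Y^h_n]=a_Y(Y^h_n)h+g_h(Y^h_n)$, $\mathbb E[(Y^h_{n+1}-Y^h_n)^l\mid Y^h_n]=j_{h,l}(Y^h_n)$ for $l\in\mathbb N^d$, $|l|=3$, where $f_h:\mathcal D\to\mathbb R^d$, $g_h:\mathcal D\to\mathbb R^{d\times d}$, $j_{h,l}:\mathcal D\to\mathbb R$ are such that, for some $p>1$ and $C>0$, $\sup_{h<\bar h}\sup_{n=0,\dots,N}\|f_h(Y^h_n)\|_p\le Ch^2$, and likewise $\|g_h(Y^h_n)\|_p\le Ch^2$ and $\|j_{h,l}(Y^h_n)\|_p\le Ch^2$ for $|l|=3$ (i.e. the bounds hold for all such $h,n$, with $C$ independent of $h,n$). Assumption $\mathcal H_2$: there exists $\bar h>0$ such that for every $p>1$ there is $C_p>0$ with $\|Y^h_n\|_p\le C_p$ for all $h<\bar h$, $0\le n\le N$, and $\|Y^h_{n+1}-Y^h_n\|_p\le C_p\sqrt h$ for all $h<\bar h$, $0\le n\le N-1$. *)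

(* Defs.v *)
From HB Require Import structures.
From mathcomp Require Import all_boot all_order all_algebra.
From mathcomp Require Import all_classical all_reals all_analysis.

Set Implicit Arguments.
Unset Strict Implicit.
Unset Printing Implicit Defensive.
Import Order.TTheory GRing.Theory Num.Theory.
Import numFieldNormedType.Exports.
Local Open Scope classical_set_scope.
Local Open Scope ring_scope.

(* Points of R^d are row vectors, so that the matrix-vector product A y is
   [y *m A^T] and the matrix y y^* is [y^T *m y].  The topology of ['rV[R]_d]
   comes from the sup norm; it is the usual one. *)

Section euclidean.
Context {R : realType} {d : nat}.

Definition enorm (y : 'rV[R]_d) : R := Num.sqrt (\sum_i (y 0 i) ^+ 2).

Definition opnorm (A : 'M[R]_d) : R :=
  sup [set enorm (y *m A^T) | y in [set y | enorm y <= 1]].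

Definition multi := {ffun 'I_d -> nat}.

Definition mlen (l : multi) : nat := (\sum_i l i)%N.

Definition m0 : multi := [ffun=> 0%N].

Definition madd1 (l : multi) (i : 'I_d) : multi :=
  [ffun j => (l j + (j == i))%N].

Definition monom (y : 'rV[R]_d) (l : multi) : R := \prod_i (y 0 i) ^+ l i.

(* A convex open nonempty set is connected, hence a domain. *)
Definition convex_domain (A : set 'rV[R]_d) : Prop :=
  [/\ open A, A !=set0 & convex_set A].

End euclidean.
Arguments multi d : clear implicits.

Section smoothness.
Context {R : realType} {d : nat}.
Implicit Types (D : set 'rV[R]_d) (v : R -> 'rV[R]_d -> R) (T : R).

(* [derivs q T D v Dv]: for 2k + |l| <= q, [Dv k l] is the derivative
   d_t^k d_y^l v on [0, T) x D.  Derivatives are taken at interior points, and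
   are required to extend continuously to the points of {0} x D and of the
   boundary of D that belong to the domain; [Dv k l] includes this extension,
   which is unique since D is included in the closure of its interior. *)
Definition derivs (q : nat) T D v
    (Dv : nat -> multi d -> R -> 'rV[R]_d -> R) : Prop :=
  [/\ forall t y, 0 <= t < T -> D y -> Dv 0%N m0 t y = v t y,
      forall k l, (2 * k + mlen l <= q)%N ->
        {within [set z : R * 'rV[R]_d | 0 <= z.1 < T /\ D z.2],
          continuous (fun z => Dv k l z.1 z.2)},
      forall k l t y, (2 * k.+1 + mlen l <= q)%N -> 0 < t < T -> D° y ->
        is_derive t 1 (fun s => Dv k l s y) (Dv k.+1 l t y) &
      forall k l i t y, (2 * k + (mlen l).+1 <= q)%N ->
        0 <= t < T -> D° y ->
        is_derive y (delta_mx 0 i) (fun x => Dv k l t x)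
          (Dv k (madd1 l i) t y)].

Definition C_pol (q : nat) T D v : Prop :=
  exists Dv, derivs q T D v Dv /\
  exists C a : R, [/\ 0 < C, 0 < a &
    forall k l t y, (2 * k + mlen l <= q)%N -> 0 <= t < T -> D y ->
      `|Dv k l t y| <= C * (1 + enorm y `^ a)].

Definition poly_growth D (b : 'rV[R]_d -> 'rV[R]_d) : Prop :=
  exists C a : R, [/\ 0 < C, 0 < a &
    forall y, D y -> enorm (b y) <= C * (1 + enorm y `^ a)].

Definition diffusion_mx {l : nat} (sigma : 'rV[R]_d -> 'M[R]_(d, l)) y : 'M[R]_d :=
  sigma y *m (sigma y)^T.

(* d_t u + (1/2) Tr (a D_y^2 u) + b . grad_y u = 0 on [0, T) x D and
   u(T, .) = f on D. *)
Definition classical_solution T D (b : 'rV[R]_d -> 'rV[R]_d)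
    (a : 'rV[R]_d -> 'M[R]_d) (f : 'rV[R]_d -> R) v : Prop :=
  [/\ {within [set z : R * 'rV[R]_d | 0 <= z.1 <= T /\ D z.2],
         continuous (fun z => v z.1 z.2)},
      forall y, D y -> v T y = f y &
      exists Dv, derivs 2 T D v Dv /\
        forall t y, 0 <= t < T -> D y ->
          Dv 1%N m0 t y
          + 2^-1 * \tr (a y *m \matrix_(i, j) Dv 0%N (madd1 (madd1 m0 i) j) t y)
          + \sum_i b y 0 i * Dv 0%N (madd1 m0 i) t y = 0].

End smoothness.

Section probability.
Context {R : realType} {dO : measure_display} {O : measurableType dO}.
Variable P : probability O R.
Implicit Types (G : set (set O)) (Z : O -> R).

Definition meas_wrt G Z : Prop :=
  forall B : set R, measurable B -> G (Z @^-1` B).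

(* The sigma-algebra generated by the random vectors X_i, i in S. *)
Definition sigma_gen {d} {I : Type} (X : I -> O -> 'rV[R]_d) (S : set I) :
    set (set O) :=
  <<s [set A | exists i k (B : set R),
        [/\ S i, measurable B & A = [set w | B (X i w 0 k)]] ]>>.

(* Z is a version of the conditional expectation of V given G. *)
Definition is_cexp G (V Z : O -> R) : Prop :=
  [/\ P.-integrable setT (EFin \o V), P.-integrable setT (EFin \o Z),
      meas_wrt G Z &
      forall A, G A ->
        (\int[P]_(w in A) ((Z w)%:E) = \int[P]_(w in A) ((V w)%:E))%E].

Definition random_vector {d} (X : O -> 'rV[R]_d) : Prop :=
  forall i, measurable_fun setT (fun w => X w 0 i).

(* ||X||_p <= c for a real, vector (Euclidean norm) or matrix (operator norm)
   valued X; membership in L^p includes measurability. *)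
Definition Lp_le (p : R) (X : O -> R) (c : R) : Prop :=
  measurable_fun setT X /\
  ('N[P]_(p%:E)[(fun w => (X w)%:E)] <= c%:E)%E.

Definition Lp_le_vec {d} (p : R) (X : O -> 'rV[R]_d) (c : R) : Prop :=
  random_vector X /\
  ('N[P]_(p%:E)[(fun w => (enorm (X w))%:E)] <= c%:E)%E.

Definition Lp_le_mx {d} (p : R) (X : O -> 'M[R]_d) (c : R) : Prop :=
  (forall i j, measurable_fun setT (fun w => X w i j)) /\
  ('N[P]_(p%:E)[(fun w => (opnorm (X w))%:E)] <= c%:E)%E.

(* Markov chain (X_n)_{n <= N} with values in D and X_0 = y0; it is not
   required to be time-homogeneous. *)
Definition markov_chain {d} (D : set 'rV[R]_d) (y0 : 'rV[R]_d) (N : nat)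
    (X : nat -> O -> 'rV[R]_d) : Prop :=
  [/\ forall n, (n <= N)%N -> random_vector (X n),
      forall n w, (n <= N)%N -> D (X n w),
      forall w, X 0%N w = y0 &
      forall n A, (n < N)%N -> sigma_gen X [set n.+1] A ->
        exists2 Z, meas_wrt (sigma_gen X [set n]) Z &
          is_cexp (sigma_gen X [set k | (k <= n)%N]) (\1_A) Z].

Definition filtration (F : R -> set (set O)) : Prop :=
  [/\ forall s, 0 <= s -> sigma_algebra setT (F s),
      forall s, 0 <= s -> F s `<=` measurable &
      forall s r, 0 <= s <= r -> F s `<=` F r].

(* Standard l-dimensional Brownian motion with respect to F: the last clause
   says that W_r - W_s is independent of F_s, with independent components of
   law N(0, r - s). *)
Definition brownian_motion {l} (F : R -> set (set O)) (W : R -> O -> 'rV[R]_l)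
    : Prop :=
  [/\ forall s j, 0 <= s -> meas_wrt (F s) (fun w => W s w 0 j),
      \forall w \ae P, W 0 w = 0,
      forall w j, {within [set s | 0 <= s], continuous (fun s => W s w 0 j)} &
      forall s r A (B : 'I_l -> set R), 0 <= s < r -> F s A ->
        (forall j, measurable (B j)) ->
        (P (A `&` [set w | forall j, B j (W r w 0 j - W s w 0 j)%R]) =
         P A * \prod_(j < l) normal_prob 0 (Num.sqrt (r - s)) (B j))%E].

(* The simple process sum_{k < sp_n} sp_xi_k 1_{(sp_t_k, sp_t_(k+1)]}. *)
Record simple_process := SimpleProcess {
  sp_n : nat; sp_t : nat -> R; sp_xi : nat -> O -> R }.

Definition is_simple (F : R -> set (set O)) (t T : R) (S : simple_process) :
    Prop :=
  [/\ forall k, (k < sp_n S)%N -> sp_t S k <= sp_t S k.+1,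
      t <= sp_t S 0%N, sp_t S (sp_n S) <= T &
      forall k, (k < sp_n S)%N -> meas_wrt (F (sp_t S k)) (sp_xi S k) /\
        exists M, forall w, `|sp_xi S k w| <= M].

Definition sp_val (S : simple_process) (r : R) (w : O) : R :=
  \sum_(k < sp_n S) sp_xi S k w * \1_(`]sp_t S k, sp_t S k.+1]) r.

Definition sp_ito (B : R -> O -> R) (S : simple_process) (s : R) (w : O) : R :=
  \sum_(k < sp_n S)
    sp_xi S k w * (B (Num.min (sp_t S k.+1) s) w - B (Num.min (sp_t S k) s) w).

Definition cvg0_in_prob (Z : nat -> O -> \bar R) : Prop :=
  forall e : R, 0 < e -> P [set w | (e%:E <= Z n w)%E] @[n --> \oo] --> 0%E.

(* On [t, s] x O, the process H is B([t, s]) (x) F_s-measurable. *)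
Definition progressive (F : R -> set (set O)) (t T : R) (H : R -> O -> R) :
    Prop :=
  forall s (B : set R), t <= s <= T -> measurable B ->
    <<s [set E : set (R * O) | exists A1 A2,
          [/\ measurable A1, F s A2 & E = A1 `*` A2] ]>>
      [set z | t <= z.1 <= s /\ B (H z.1 z.2)].

(* X_s = int_t^s H_r dB_r for s in [t, T], where int_t^T H_r^2 dr < oo a.s.:
   X is the continuous adapted process obtained as the limit in probability of
   integrals of simple processes approximating H. *)
Definition is_ito_integral (F : R -> set (set O)) (t T : R) (B : R -> O -> R)
    (H X : R -> O -> R) : Prop :=
  [/\ progressive F t T H,
      \forall w \ae P,
        (\int[lebesgue_measure]_(r in `[t, T]) ((H r w) ^+ 2)%:E < +oo)%E,
      forall s, t <= s <= T -> meas_wrt (F s) (X s),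
      forall w, {within `[t, T], continuous (fun s => X s w)} &
      exists S : nat -> simple_process,
      [/\ forall n, is_simple F t T (S n),
          cvg0_in_prob (fun n w => (\int[lebesgue_measure]_(r in `[t, T])
             ((sp_val (S n) r w - H r w) ^+ 2)%:E)%E) &
          forall s, t <= s <= T ->
            cvg0_in_prob (fun n w => (`|sp_ito B (S n) s w - X s w|)%:E)] ].

(* (Y_s)_{s in [t, T]} is a D-valued weak solution of
   dY = b(Y) ds + sigma(Y) dW, Y_t = y, carried by the filtered probability
   space (O, F, P) and the F-Brownian motion W.  Since b and sigma are only
   relevant on D, they are replaced by 0 outside D (on the null set where Y
   leaves D). *)
Definition weak_solution {d l} (D : set 'rV[R]_d)
    (b : 'rV[R]_d -> 'rV[R]_d) (sigma : 'rV[R]_d -> 'M[R]_(d, l))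
    (t T : R) (y : 'rV[R]_d) (F : R -> set (set O)) (W : R -> O -> 'rV[R]_l)
    (Y : R -> O -> 'rV[R]_d) : Prop :=
  [/\ filtration F /\ brownian_motion F W,
      (forall s i, t <= s <= T -> meas_wrt (F s) (fun w => Y s w 0 i)) /\
      (forall w i, {within `[t, T], continuous (fun s => Y s w 0 i)}),
      \forall w \ae P, Y t w = y,
      \forall w \ae P, forall s, t <= s <= T -> D (Y s w) &
      exists M : 'I_d -> 'I_l -> R -> O -> R,
      [/\ forall i j, is_ito_integral F t T (fun s w => W s w 0 j)
            (fun s w => patch (cst 0) D sigma (Y s w) i j) (M i j),
          forall i, \forall w \ae P,
            lebesgue_measure.-integrable `[t, T]
              (fun r => (patch (cst 0) D b (Y r w) 0 i)%:E) &
          forall i, \forall w \ae P, forall s, t <= s <= T ->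
            Y s w 0 i = y 0 i
              + \int[lebesgue_measure]_(r in `[t, s])
                  (patch (cst 0) D b (Y r w) 0 i)
              + \sum_(j < l) M i j s w] ].

End probability.

(* Equality of the laws of two processes indexed by [t, T], as measures on the
   cylinder sigma-algebra of the path space. *)
Definition same_law {R : realType} {d : nat} (t T : R)
    {dO1} {O1 : measurableType dO1} (P1 : probability O1 R)
    (Y1 : R -> O1 -> 'rV[R]_d)
    {dO2} {O2 : measurableType dO2} (P2 : probability O2 R)
    (Y2 : R -> O2 -> 'rV[R]_d) : Prop :=
  forall A : set (R -> 'rV[R]_d),
    <<s [set C | exists s i (B : set R),
          [/\ t <= s <= T, measurable B & C = [set x : R -> 'rV[R]_d | B (x s 0 i)]] ]>> A ->
    P1 [set w | A (Y1 ^~ w)] = P2 [set w | A (Y2 ^~ w)].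

Section sde.
Context {R : realType} {d l : nat}.
Variables (T : R) (D : set 'rV[R]_d) (b : 'rV[R]_d -> 'rV[R]_d).
Variable sigma : 'rV[R]_d -> 'M[R]_(d, l).

(* Weak existence and uniqueness in law from every (t, y) in [0, T] x D. *)
Definition well_posed : Prop :=
  forall t y, 0 <= t <= T -> D y ->
    (exists (dO : measure_display) (O : measurableType dO)
            (P : probability O R) F W Y,
        weak_solution P D b sigma t T y F W Y) /\
    (forall (dO1 : measure_display) (O1 : measurableType dO1)
            (P1 : probability O1 R) F1 W1 Y1
            (dO2 : measure_display) (O2 : measurableType dO2)
            (P2 : probability O2 R) F2 W2 Y2,
        weak_solution P1 D b sigma t T y F1 W1 Y1 ->
        weak_solution P2 D b sigma t T y F2 W2 Y2 ->
        same_law t T P1 Y1 P2 Y2).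

(* u(t, y) = E[f(Y_T^{t,y})]. The equality in the extended reals with a finite
   value includes the integrability of f(Y_T^{t,y}). *)
Definition is_value_function (f : 'rV[R]_d -> R) (u : R -> 'rV[R]_d -> R) :
    Prop :=
  forall t y, 0 <= t <= T -> D y ->
  forall (dO : measure_display) (O : measurableType dO)
         (P : probability O R) F W Y,
    weak_solution P D b sigma t T y F W Y ->
    ('E_P[(fun w => f (Y T w))] = (u t y)%:E)%E.

Variables (dO : nat -> measure_display) (O : forall N, measurableType (dO N)).
Variable P : forall N, probability (O N) R.
(* [X N n] is Y^h_n for h = T / N. *)
Variable X : forall N, nat -> O N -> 'rV[R]_d.

Definition assumption_H1 : Prop :=
  exists hbar : R, 0 < hbar /\
  exists (f : R -> 'rV[R]_d -> 'rV[R]_d) (g : R -> 'rV[R]_d -> 'M[R]_d)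
         (j : R -> multi d -> 'rV[R]_d -> R) (p C : R),
  [/\ 1 < p, 0 < C &
  forall N, (0 < N)%N -> let h := T / N%:R in h < hbar ->
  (forall n, (n < N)%N ->
     let dX w := X n.+1 w - @X N n w in
     let G := sigma_gen (@X N) [set n] in
     [/\ forall i, is_cexp (P N) G (fun w => dX w 0 i)
           (fun w => b (X n w) 0 i * h + f h (X n w) 0 i),
         forall i k, is_cexp (P N) G (fun w => ((dX w)^T *m dX w) i k)
           (fun w => diffusion_mx sigma (X n w) i k * h + g h (X n w) i k) &
         forall m, mlen m = 3%N -> is_cexp (P N) G (fun w => monom (dX w) m)
           (fun w => j h m (X n w))]) /\
  (forall n, (n <= N)%N ->
     [/\ Lp_le_vec (P N) p (fun w => f h (X n w)) (C * h ^+ 2),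
         Lp_le_mx (P N) p (fun w => g h (X n w)) (C * h ^+ 2) &
         forall m, mlen m = 3%N ->
           Lp_le (P N) p (fun w => j h m (X n w)) (C * h ^+ 2)])].

Definition assumption_H2 : Prop :=
  exists hbar : R, 0 < hbar /\
  forall p : R, 1 < p -> exists C : R, 0 < C /\
  forall N, (0 < N)%N -> let h := T / N%:R in h < hbar ->
  (forall n, (n <= N)%N -> Lp_le_vec (P N) p (@X N n) C) /\
  (forall n, (n < N)%N ->
     Lp_le_vec (P N) p (fun w => X n.+1 w - @X N n w) (C * Num.sqrt h)).

End sde.

(* Main.v *)
Require Import Defs.
From HB Require Import structures.
From mathcomp Require Import all_boot all_order all_algebra.
From mathcomp Require Import all_classical all_reals all_analysis.
From mathcomp Require Import measurable_realfun ring lra.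
Set Implicit Arguments.
Unset Strict Implicit.
Unset Printing Implicit Defensive.
Import Order.TTheory GRing.Theory Num.Theory.
Import numFieldNormedType.Exports.
Local Open Scope classical_set_scope.
Local Open Scope ring_scope.

(* With t_n = n h, the error is the telescoping sum over n < N of
   E u(t_(n+1), X_(n+1)) - E u(t_n, X_n), so it suffices that each term is
   O(h^2).  Expand first in time at X_(n+1), then in space at t_n: with
   v = X_(n+1) - X_n, the increment of u is
     h d_t u + D u v + D^2 u v^2 / 2 + D^3 u v^3 / 6 + h D d_t u v
   at (t_n, X_n), up to a remainder of order h^2 + h |v|^2 + |v|^4 with
   polynomially growing coefficients, whose mean is O(h^2) by the moment
   bounds.  Conditioning on X_n replaces the powers of v by their conditional
   moments; the terms of order h cancel by the PDE, and what remains is f_h,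
   g_h, j_h, of size h^2 in L^p, against functions of X_n of polynomial growth.
   The derivatives of u exist only inside the domain and before T; the
   expansions are proved there and extended to the closure by continuity. *)

(** * Extension to the closure and Taylor expansions *)

(** The smoothness assumption gives partial derivatives along the coordinate axes only; strict
    derivatives serve to add them up along v. Because time is expanded first, at X_(n+1), every
    derivative in the expansion is taken at t_n < T, although t_(n+1) may be T. A time derivative
    counts for two orders, so the remainders of second order in time, second order in space for d_t
    u and fourth order in space for u use exactly the four orders available. The mixed term h D d_t
    u v has conditional mean h D d_t u (h mu + f_h), of order h^2 by the growth of mu. The
    derivatives that grow polynomially and those that satisfy the PDE come from two existential
    statements and have to be identified. Growth is measured by [weight], which is at least 1, so
    that all its powers are bounded by a single one. Products are split into separate moments by
    Young inequalities instead of Hölder's. With r = |v| / sqrt h the remainder is h^2 (1 + r^2 +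
    r^4) times two weights; cubing the three factors leads to the moment of order 12 of v, which is
    O(h^6). *)

Section closure_extension.
Context {R : realType} {U : topologicalType}.

(** A point of [D] is a limit of points of [A], so the neighbourhoods traced on [A] form a proper
    filter, along which a closed inequality passes to the limit. *)
Lemma within_closure_le (A D : set U) (F : U -> R) (c : R) :
  A `<=` D -> D `<=` closure A -> {within D, continuous F} ->
  (forall x, A x -> F x <= c) -> forall x, D x -> F x <= c.
Proof.
move=> AD DA /subspace_continuousP cF FA x Dx.
have FF : ProperFilter (within A (nbhs x)).
  by apply: within_nbhs_proper; exact: DA.
have cA : F @ within A (nbhs x) --> F x.
  apply: cvg_trans (cF x Dx) => S; rewrite /= /nbhs /= /fmap /within /=.
  by apply: filterS => y + Ay; apply; exact: AD.
apply: (@closed_cvg _ _ (within A (nbhs x)) _ F (fun z => z <= c)) cA.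
- exact: closed_le.
- by rewrite near_withinE; apply: nearW => y; exact: FA.
Qed.

Lemma within_closure_eq (A D : set U) (F G : U -> R) :
  A `<=` D -> D `<=` closure A ->
  {within D, continuous F} -> {within D, continuous G} ->
  (forall x, A x -> F x = G x) -> forall x, D x -> F x = G x.
Proof.
move=> AD DA cF cG FG x Dx.
have c1 : {within D, continuous (F \- G)} by apply: within_continuousB.
have c2 : {within D, continuous (G \- F)} by apply: within_continuousB.
apply/eqP; rewrite eq_le -subr_le0 -(subr_le0 (F x)).
apply/andP; split.
- by apply: (within_closure_le AD DA c1 (c := 0)) => // y Ay; rewrite /= FG ?subrr.
- by apply: (within_closure_le AD DA c2 (c := 0)) => // y Ay; rewrite /= FG ?subrr.
Qed.

End closure_extension.

Lemma within_comp {U V W : topologicalType} (S : set U) (S' : set V)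
    (g : U -> V) (F : V -> W) :
  continuous g -> (forall x, S x -> S' (g x)) ->
  {within S', continuous F} -> {within S, continuous (F \o g)}.
Proof.
move=> cg gS /subspace_continuousP cF; apply/subspace_continuousP => x Sx.
move=> B /(cF _ (gS _ Sx)); rewrite /= /nbhs /= /within /= => h.
have := cg x _ h; rewrite /= /nbhs /=.
by apply: filterS => y /= + Sy; apply; exact: gS.
Qed.

Lemma within_slicel {U V W : topologicalType} (S : set (U * V)) (D : set V)
    (F : U * V -> W) x :
  {within S, continuous F} -> (forall y, D y -> S (x, y)) ->
  {within D, continuous (fun y => F (x, y))}.
Proof.
move=> cF DS; apply: within_comp cF => // y.
have c1 : (cst x : V -> U) @ y --> x by exact: cst_continuous.
have c2 : id @ y --> y by exact: cvg_id.
exact: (cvg_pair c1 c2).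
Qed.

Lemma within_slicer {U V W : topologicalType} (S : set (U * V)) (D : set U)
    (F : U * V -> W) y :
  {within S, continuous F} -> (forall x, D x -> S (x, y)) ->
  {within D, continuous (fun x => F (x, y))}.
Proof.
move=> cF DS; apply: within_comp cF => // x.
have c1 : (cst y : U -> V) @ x --> y by exact: cst_continuous.
have c2 : id @ x --> x by exact: cvg_id.
exact: (cvg_pair c2 c1).
Qed.

(** * Taylor bound in one variable *)

Section one_dim.
Context {R : realType}.

Lemma is_derive_mean_bound (f df : R -> R) (M : R) (s : R) :
  0 <= s -> (forall x, 0 <= x <= s -> is_derive x 1 f (df x)) ->
  (forall x, 0 <= x <= s -> `|df x| <= M) ->
  `|f s - f 0| <= M * s.
Proof.
move=> s0 fd fM.
have cf : {within `[0, s], continuous f}.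
  apply: derivable_within_continuous => x; rewrite in_itv /= => xs.
  by have [] := fd x xs.
have dfs x : x \in `]0, s[ -> is_derive x 1 f (df x).
  by rewrite in_itv /= => /andP[x0 xs]; apply: fd; rewrite !ltW.
have [c cs ->] := MVT_segment s0 dfs cf.
rewrite in_itv /= in cs; rewrite subr0 normrM (ger0_norm s0) ler_wpM2r//.
exact: fM.
Qed.

(** The remainder vanishes at 0 and its derivative is the remainder of lower order of the shifted
    family, so induction and the mean value theorem suffice. Since s <= 1 each integration keeps the
    bound [M]; the factor 1 / n! is given up. *)
Lemma taylor_bound (n : nat) (phi : nat -> R -> R) (M : R) :
  (forall k (x : R), (k < n)%N -> 0 <= x <= 1 ->
     is_derive x 1 (phi k) (phi k.+1 x)) ->
  (forall x : R, 0 <= x <= 1 -> `|phi n x| <= M) ->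
  forall s : R, 0 <= s <= 1 ->
  `|phi 0%N s - \sum_(k < n) phi k 0 * s ^+ k / k`!%:R| <= M.
Proof.
elim: n phi => [|n IH] phi dphi phiM s s01.
  by rewrite big_ord0 subr0; exact: phiM.
have M0 : 0 <= M by apply: le_trans (phiM 0 _); rewrite ?lexx ?ler01.
pose f x := phi 0%N x - \sum_(k < n.+1) phi k 0 * x ^+ k / k`!%:R.
pose df x := phi 1%N x - \sum_(k < n) phi k.+1 0 * x ^+ k / k`!%:R.
have f0 : f 0 = 0.
  rewrite /f big_ord_recl expr0 mulr1 fact0 divr1 big1 ?addr0 ?subrr//.
  by move=> i _; rewrite exprS mul0r mulr0 mul0r.
have fd (x : R) : 0 <= x <= 1 -> is_derive x 1 f (df x).
  move=> x01; rewrite /f /df.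
  have -> : (fun x => phi 0%N x - \sum_(k < n.+1) phi k 0 * x ^+ k / k`!%:R) =
     phi 0%N \- (\sum_(k < n.+1) (phi k 0 / k`!%:R) *: (@GRing.exp R ^~ k)).
    apply/funext => y /=; congr (_ - _).
    rewrite fct_sumE; apply: eq_bigr => i _.
    by rewrite /GRing.scale /= mulrAC.
  have d0 := dphi 0%N x isT x01.
  apply: is_deriveB.
  (* Termwise derivative: the constant term drops out and (k + 1) / (k + 1)! = 1 / k!. *)
  have -> : \sum_(k < n) phi k.+1 0 * x ^+ k / k`!%:R =
    \sum_(k < n.+1) (phi k 0 / k`!%:R) *: (k%:R * x ^+ k.-1).
    rewrite big_ord_recl mul0r scaler0 add0r; apply: eq_bigr => i _.
    rewrite lift0 /= factS natrM /GRing.scale /=.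
    have h1 : i.+1%:R != 0 :> R by rewrite pnatr_eq0.
    have h2 : i`!%:R != 0 :> R by rewrite pnatr_eq0 -lt0n fact_gt0.
    by field; rewrite h2 nat1r h1.
  apply: is_derive_sum => i; apply: is_deriveZ.
  apply: DeriveDef; first exact: exprn_derivable.
  by rewrite exp_derive /GRing.scale /= mulr1.
have dfM (x : R) : 0 <= x <= 1 -> `|df x| <= M.
  move=> x01; apply: (IH (fun k => phi k.+1)) => //.
  by move=> k y kn; apply: dphi.
have /andP[s0 s1] := s01.
apply: (@le_trans _ _ (M * s)); last by rewrite ler_piMr.
rewrite -[leLHS]/`|f s| -[f s]subr0 -f0.
apply: (is_derive_mean_bound (df := df) s0) => x /andP[x0 xs].
- by apply: fd; rewrite x0 (le_trans xs).
- by apply: dfM; rewrite x0 (le_trans xs).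
Qed.

End one_dim.

(* The increments of g are close to L along v uniformly in the base point: this
   strict form, unlike Gateaux derivability, is additive in v. *)
Definition strict_derive {R : realType} {d : nat} (g : 'rV[R]_d -> R)
    (x v : 'rV[R]_d) (L : R) :=
  forall e, 0 < e -> \forall z \near (x, 0 : R),
    `|g (z.1 + z.2 *: v) - g z.1 - z.2 * L| <= e * `|z.2|.

Section strict_derivative.
Context {R : realType} {d : nat}.
Implicit Types (x v w : 'rV[R]_d) (g : 'rV[R]_d -> R).

Lemma strict_derive0 g x : strict_derive g x 0 0.
Proof.
move=> e e0; near=> z.
by rewrite scaler0 addr0 subrr mulr0 subrr normr0 mulr_ge0// ltW.
Unshelve. all: by end_near. Qed.

(** The increment along v + w is an increment along v followed by one along w from the displaced
    point; uniformity in the base point covers the second. *)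
Lemma strict_deriveD g x v w L M :
  strict_derive g x v L -> strict_derive g x w M ->
  strict_derive g x (v + w) (L + M).
Proof.
move=> gv gw e e0; have e20 : 0 < e / 2 by rewrite divr_gt0.
have c1 : z.1 + z.2 *: v @[z --> ((x, 0) : 'rV[R]_d * R)]
    --> x + (0 : R) *: v.
  by apply: cvgD; [exact: cvg_fst|apply: cvgZr_tmp; exact: cvg_snd].
rewrite scale0r addr0 in c1.
have c2 : z.2 @[z --> ((x, 0) : 'rV[R]_d * R)] --> (0 : R) by exact: cvg_snd.
have cont := cvg_pair c1 c2.
near=> z.
have h1 : `|g (z.1 + z.2 *: v) - g z.1 - z.2 * L| <= e / 2 * `|z.2|.
  by near: z; exact: gv.
have h2 : `|g (z.1 + z.2 *: v + z.2 *: w) - g (z.1 + z.2 *: v) - z.2 * M|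
    <= e / 2 * `|z.2|.
  by near: z; exact: (cont _ _ _ _ (gw _ e20)).
rewrite scalerDr addrA [e]splitr mulrDl mulrDr.
rewrite (_ : _ - _ - _ =
  (g (z.1 + z.2 *: v + z.2 *: w) - g (z.1 + z.2 *: v) - z.2 * M)
  + (g (z.1 + z.2 *: v) - g z.1 - z.2 * L)); last by ring.
by rewrite (le_trans (ler_normD _ _))// lerD.
Unshelve. all: by end_near. Qed.

Lemma strict_derive_sum (I : finType) g x (v : I -> 'rV[R]_d) (L : I -> R) :
  (forall i, strict_derive g x (v i) (L i)) ->
  strict_derive g x (\sum_i v i) (\sum_i L i).
Proof.
move=> h; elim/big_ind2 : _ => [|v1 L1 v2 L2|i _].
- exact: strict_derive0.
- exact: strict_deriveD.
- exact: h.
Qed.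

Lemma strict_derive_is_derive g x v L :
  strict_derive g x v L -> is_derive x v g L.
Proof.
move=> gL.
have c : (fun h => h^-1 *: (g (h *: v + x) - g x)) h @[h --> 0^'] --> L.
  apply/cvgrPdist_le => e e0.
  have c2 : h @[h --> (0 : R)^'] --> (0 : R) by exact: nbhs_dnbhs.
  have cont := cvg_pair (cvg_cst x : cst x h @[h --> (0 : R)^'] --> x) c2.
  have H := cont _ _ _ _ _ (gL e e0).
  near=> h.
  have h0 : h != 0 by near: h; exact: nbhs_dnbhs_neq.
  have : `|g (x + h *: v) - g x - h * L| <= e * `|h| by near: h; exact: H.
  rewrite (_ : L - _ = - (h^-1 * (g (x + h *: v) - g x - h * L))); last first.
    rewrite [h *: v + x]addrC /GRing.scale /=.
    by field.
  move=> k; rewrite normrN normrM normrV ?unitfE// mulrC.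
  by rewrite ler_pdivrMr ?normr_gt0.
apply: DeriveDef; first by apply/cvg_ex; exists L.
exact/cvg_lim.
Unshelve. all: by end_near. Qed.

Lemma is_derive_line g x v s L :
  is_derive (x + s *: v) v g L -> is_derive s 1 (fun r => g (x + r *: v)) L.
Proof.
have E : (fun h => h^-1 *: (g (h *: v + (x + s *: v)) - g (x + s *: v))) =
   (fun h => h^-1 *: ((fun r => g (x + r *: v)) (h *: 1 + s)
                      - (fun r => g (x + r *: v)) s)).
  apply/funext => h /=; congr (_ *: (g _ - _)).
  by rewrite scalerDl [h%:A]mulr1 addrCA.
move=> [dg <-]; apply: DeriveDef; first by rewrite /derivable -E.
by rewrite /derive -E.
Qed.

(** Here continuity of the derivative is used: on a ball around x, [g'] is almost constant, and the
    mean value theorem along the segment bounds the error independently of the base point. *)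
Lemma strict_derive_partial (B : set 'rV[R]_d) g g' x v (c : R) :
  open B -> B x -> (forall y, B y -> is_derive y v g (g' y)) ->
  {for x, continuous g'} -> strict_derive g x (c *: v) (c * g' x).
Proof.
move=> oB Bx dg cg' e e0.
(* The 1 in the denominator allows c = 0. *)
pose e1 := e / (1 + `|c|).
have e10 : 0 < e1 by rewrite divr_gt0// ltr_wpDr.
have : \forall y \near x, B y /\ `|g' x - g' y| <= e1.
  apply: filterI; first exact: open_nbhs_nbhs.
  by move/cvgrPdist_le : cg'; apply.
move=> /nbhs_ballP[r /= r0 Br].
have cont : (fun z : 'rV[R]_d * R => z.1 + z.2 *: (c *: v)) z
    @[z --> (x, 0 : R)] --> x + (0 : R) *: (c *: v).
  by apply: cvgD; [exact: cvg_fst|apply: cvgZr_tmp; exact: cvg_snd].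
rewrite scale0r addr0 in cont.
near=> z.
have bz : ball x r z.1.
  near: z; exact: (cvg_fst (nbhsx_ballx x r r0)).
have bz' : ball x r (z.1 + z.2 *: (c *: v)).
  near: z; exact: (cont _ (nbhsx_ballx x r r0)).
(* Balls are convex: the segment stays where [g'] is controlled. *)
have bs (s : R) : 0 <= s <= 1 -> ball x r (z.1 + s *: (z.2 *: (c *: v))).
  move=> s01; move: bz bz'; rewrite -!ball_normE /= => b1 b2.
  rewrite (_ : x - _ = (1 - s) *: (x - z.1)
     + s *: (x - (z.1 + z.2 *: (c *: v)))); last first.
    apply/rowP => i; rewrite !mxE; ring.
  have /andP[s0 s1] := s01.
  rewrite (le_lt_trans (ler_normD _ _))// !normrZ (ger0_norm s0).
  rewrite (ger0_norm (_ : 0 <= 1 - s)) ?subr_ge0//.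
  move: s0; rewrite le_eqVlt => /predU1P[<-|s0].
    by rewrite subr0 mul1r mul0r addr0.
  rewrite [ltRHS](_ : r = (1 - s) * r + s * r); last by ring.
  by rewrite ler_ltD ?ltr_pM2l// ler_wpM2l ?subr_ge0// ltW.
pose f s := g (z.1 + s *: (z.2 *: (c *: v))) - s * (z.2 * (c * g' x)).
pose df s := z.2 * c * g' (z.1 + s *: (z.2 *: (c *: v))) - z.2 * (c * g' x).
have fd (s : R) : 0 <= s <= 1 -> is_derive s 1 f (df s).
  move=> s01; apply: is_deriveB.
    have [Bs _] := Br _ (bs s s01).
    have E k : z.1 + k *: (z.2 *: (c *: v)) = z.1 + (z.2 * c * k) *: v.
      by rewrite !scalerA; congr (_ + _ *: _); ring.
    rewrite E in Bs.
    have H1 := @is_deriveZ R R R id (z.2 * c) s 1 1 (is_derive_id s 1).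
    rewrite /GRing.scale /= mulr1 in H1.
    have H2 := is_derive_line (dg _ Bs).
    have H := @is_derive1_comp _ (fun k => g (z.1 + k *: v))
      (fun k => z.2 * c * k) s _ _ H2 H1.
    rewrite [X in is_derive _ _ X _](_ : _ =
      (fun k => g (z.1 + k *: v)) \o (fun k => z.2 * c * k)); last first.
      by apply/funext => k /=; rewrite E.
    by rewrite E [_ * g' _]mulrC.
  have := @is_deriveZ R R R id (z.2 * (c * g' x)) s 1 1 (is_derive_id s 1).
  rewrite /GRing.scale /= mulr1.
  congr (is_derive _ _ _ _); apply/funext => k; exact: mulrC.
have dfM (s : R) : 0 <= s <= 1 -> `|df s| <= e * `|z.2|.
  move=> s01; have [_ h] := Br _ (bs s s01).
  rewrite /df mulrA -mulrBr !normrM distrC (mulrC e) -mulrA ler_wpM2l//.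
  rewrite (le_trans (ler_wpM2l _ h))// /e1 mulrA ler_pdivrMr ?ltr_wpDr//.
  rewrite mulrC ler_wpM2l ?(ltW e0)// lerDr//.
have := is_derive_mean_bound ler01 fd dfM.
rewrite /f scale1r mul1r scale0r mul0r addr0 subr0 mulr1.
by rewrite addrAC.
Unshelve. all: by end_near. Qed.

End strict_derivative.

Lemma subset_closureX {U V : topologicalType} (A1 D1 : set U) (A2 D2 : set V) :
  D1 `<=` closure A1 -> D2 `<=` closure A2 ->
  [set z | D1 z.1 /\ D2 z.2] `<=` closure [set z | A1 z.1 /\ A2 z.2].
Proof.
move=> h1 h2 [x y] /= [Dx Dy] B [[B1 B2] /= [B1x B2y] sB].
have [x' [Ax' B1x']] := h1 x Dx B1 B1x.
have [y' [Ay' B2y']] := h2 y Dy B2 B2y.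
by exists (x', y'); split => //; apply: sB.
Qed.

Lemma within_continuous_at {U V : topologicalType} (A D : set U) (F : U -> V) x :
  open A -> A `<=` D -> {within D, continuous F} -> A x ->
  {for x, continuous F}.
Proof.
move=> oA AD /subspace_continuousP cF Ax.
have := cF x (AD _ Ax); rewrite within_interior//.
by apply: filterS AD _; exact: open_nbhs_nbhs.
Qed.

(** * Weights for polynomial growth *)

Section one_norm.
Context {R : realType} {d : nat}.
Implicit Types x y v : 'rV[R]_d.

(** The sum norm bounds the iterated coordinate sums of [dirD] with constant 1, see [dirD_bound]. *)
Definition norm1 y : R := \sum_i `|y 0 i|.

Definition weight y : R := 1 + norm1 y.

Lemma norm1_ge0 y : 0 <= norm1 y.
Proof. exact: sumr_ge0. Qed.

Lemma weight_ge1 y : 1 <= weight y.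
Proof. by rewrite lerDl norm1_ge0. Qed.

Lemma weight_ge0 y : 0 <= weight y.
Proof. exact: le_trans (weight_ge1 y). Qed.

Lemma normr_coord_norm1 y i : `|y 0 i| <= norm1 y.
Proof. by rewrite /norm1 (bigD1 i)//= lerDl sumr_ge0. Qed.

(** Taylor remainders are evaluated inside the segment; this controls their growth by the endpoints
    alone, through 1 + a + b <= (1 + a) (1 + b). *)
Lemma weight_line x v (s : R) : 0 <= s <= 1 ->
  weight (x + s *: v) <= weight x * weight (x + v).
Proof.
move=> /andP[s0 s1]; apply: (@le_trans _ _ (1 + (norm1 x + norm1 (x + v)))).
  rewrite lerD2l /norm1 -big_split /=; apply: ler_sum => i _.
  rewrite !mxE (_ : _ + s * _ = (1 - s) * x 0 i + s * (x 0 i + v 0 i)).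
    rewrite (le_trans (ler_normD _ _))// !normrM (ger0_norm s0).
    by rewrite (ger0_norm (_ : 0 <= 1 - s)) ?subr_ge0// lerD// ler_piMl// gerBl.
  by ring.
have := norm1_ge0 x; have := norm1_ge0 (x + v); rewrite /weight; nra.
Qed.

Lemma enorm_le_norm1 y : enorm y <= norm1 y.
Proof.
rewrite /enorm -[leRHS](ger0_norm (norm1_ge0 y)) -sqrtr_sqr ler_sqrt ?sqr_ge0//.
rewrite expr2 {1}/norm1 mulr_suml; apply: ler_sum => i _.
rewrite -real_normK ?num_real// expr2 ler_wpM2l//.
exact: normr_coord_norm1.
Qed.

Lemma enorm_ge0 y : 0 <= enorm y.
Proof. exact: sqrtr_ge0. Qed.

Lemma normr_coord_enorm y i : `|y 0 i| <= enorm y.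
Proof.
rewrite -sqrtr_sqr ler_wsqrtr// (bigD1 i)//= lerDl sumr_ge0// => j _.
exact: sqr_ge0.
Qed.

Lemma pol_weight (a : R) (K : nat) y : 0 < a -> a <= K%:R ->
  1 + enorm y `^ a <= 2 * weight y ^+ K.
Proof.
move=> a0 aK; have w1 := weight_ge1 y; have w0 := weight_ge0 y.
rewrite mulr_natl mulr2n lerD ?exprn_ege1//.
apply: (@le_trans _ _ (weight y `^ a)).
  rewrite ge0_ler_powR ?nnegrE ?enorm_ge0// ?(ltW a0)//.
  by rewrite (le_trans (enorm_le_norm1 y))// lerDr.
by rewrite -powR_mulrn// ler_powR.
Qed.

End one_norm.

Lemma mlen_m0 d : mlen (m0 : multi d) = 0%N.
Proof. by rewrite /mlen big1// => i _; rewrite ffunE. Qed.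

Lemma mlen_madd1 d (l : multi d) i : mlen (madd1 l i) = (mlen l).+1.
Proof.
rewrite /mlen; under eq_bigr do rewrite ffunE.
rewrite big_split /= -addn1; congr (_ + _)%N.
by rewrite (bigD1 i)//= eqxx big1// => j /negbTE ->.
Qed.

Lemma madd1C d (l : multi d) i j : madd1 (madd1 l i) j = madd1 (madd1 l j) i.
Proof. by apply/ffunP => k; rewrite !ffunE addnAC. Qed.

(** * Directional derivatives and Taylor expansion along a segment *)

Section directional.
Context {R : realType} {d : nat}.
Implicit Types (V : multi d -> 'rV[R]_d -> R) (l : multi d) (v x y : 'rV[R]_d).

(* The n-th derivative of V l in the direction v, when each V (madd1 l i) is
   the i-th partial derivative of V l. *)
Fixpoint dirD V n l v y : R :=
  if n is n'.+1 then \sum_i v 0 i * dirD V n' (madd1 l i) v y else V l y.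

(** Direction and base point vary together because the extension of the Taylor inequality to the
    closure moves both endpoints. *)
Lemma dirD_cvg {U : Type} (F : set_system U) {FF : Filter F} V
    (c p : U -> 'rV[R]_d) v y n l :
  (forall i, c z 0 i @[z --> F] --> v 0 i) ->
  (forall m, mlen m = (mlen l + n)%N -> V m (p z) @[z --> F] --> V m y) ->
  dirD V n l (c z) (p z) @[z --> F] --> dirD V n l v y.
Proof.
move=> hc; elim: n l => [|n IH] l hp; first by apply: hp; rewrite addn0.
apply: (@cvg_big _ _ _ _ _ add_continuous) => i _; apply: cvgM; first exact: hc.
by apply: IH => m; rewrite mlen_madd1 => hm; apply: hp; rewrite hm addSnnS.
Qed.

Lemma dirD_bound V n l v y M :
  (forall m, mlen m = (mlen l + n)%N -> `|V m y| <= M) ->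
  `|dirD V n l v y| <= norm1 v ^+ n * M.
Proof.
elim: n l => [|n IH] l h; first by rewrite expr0 mul1r; apply: h; rewrite addn0.
rewrite /= (le_trans (ler_norm_sum _ _ _))// exprS {1}/norm1 -mulrA mulr_suml.
apply: ler_sum => i _; rewrite normrM ler_wpM2l//; apply: IH => m.
by rewrite mlen_madd1 => hm; apply: h; rewrite hm addSnnS.
Qed.

Variables (A : set 'rV[R]_d) (V : multi d -> 'rV[R]_d -> R) (q : nat).
Hypothesis oA : open A.
Hypothesis dV : forall l i y, (mlen l < q)%N -> A y ->
  is_derive y (delta_mx 0 i) (V l) (V (madd1 l i) y).
Hypothesis cV : forall l y, (mlen l <= q)%N -> A y -> {for y, continuous (V l)}.

(** For n = 0, v is a combination of basis vectors and strict derivatives add up in the direction;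
    larger n follows by linearity. *)
Lemma is_derive_dirD n l v x (s : R) : (mlen l + n < q)%N -> A (x + s *: v) ->
  is_derive s 1 (fun r => dirD V n l v (x + r *: v))
    (dirD V n.+1 l v (x + s *: v)).
Proof.
move=> + As; elim: n l => [|n IH] l hl.
  rewrite addn0 in hl; apply: is_derive_line; apply: strict_derive_is_derive.
  rewrite [X in strict_derive _ _ X _]row_sum_delta.
  apply: strict_derive_sum => i; rewrite /=.
  apply: (strict_derive_partial (g' := V (madd1 l i)) _ oA As).
    by move=> y Ay; apply: dV.
  by apply: cV => //; rewrite mlen_madd1.
rewrite [X in is_derive _ _ X _](_ : _ =
  \sum_i (v 0 i *: (fun r => dirD V n (madd1 l i) v (x + r *: v)))); last first.
  by apply/funext => r /=; rewrite fct_sumE.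
apply: is_derive_sum => i; apply: is_deriveZ; apply: IH.
by rewrite mlen_madd1 addSnnS.
Qed.

Lemma dirD_taylor n l v x (M : R) : (mlen l + n <= q)%N ->
  (forall s, 0 <= s <= 1 -> A (x + s *: v)) ->
  (forall m (s : R), mlen m = (mlen l + n)%N -> 0 <= s <= 1 ->
     `|V m (x + s *: v)| <= M) ->
  `|V l (x + v) - \sum_(k < n) dirD V k l v x / k`!%:R| <= norm1 v ^+ n * M.
Proof.
move=> ln As VM.
have := @taylor_bound R n (fun k s => dirD V k l v (x + s *: v)) (norm1 v ^+ n * M).
move=> /(_ _ _ 1); rewrite /= ler01 lexx scale1r => H.
have := H _ _ isT; under eq_bigr do rewrite scale0r addr0 expr1n mulr1.
apply.
- move=> k s kn s01; apply: is_derive_dirD; last exact: As.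
  by rewrite (leq_trans _ ln)// ltn_add2l.
- by move=> s s01; apply: dirD_bound => m hm; apply: VM.
Qed.

End directional.

Lemma closure_itv_left {R : realType} (a b : R) :
  [set r | a <= r < b] `<=` closure [set r | a < r < b].
Proof.
move=> r /= /andP[ar rb] B /nbhs_ballP[e /= e0 Be].
pose m := r + Num.min (e / 2) ((b - r) / 2).
have m0 : 0 < Num.min (e / 2) ((b - r) / 2).
  by rewrite lt_min !divr_gt0// subr_gt0.
have m1 : Num.min (e / 2) ((b - r) / 2) <= e / 2 by rewrite ge_min lexx.
have m2 : Num.min (e / 2) ((b - r) / 2) <= (b - r) / 2.
  by rewrite ge_min lexx orbT.
exists m; split; first by rewrite /m /=; apply/andP; split; lra.
by apply: Be; rewrite -ball_normE /= /m opprD addNKr normrN gtr0_norm//; lra.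
Qed.

Lemma closure_itv_right {R : realType} (a b : R) :
  [set r | a < r <= b] `<=` closure [set r | a < r < b].
Proof.
move=> r /= /andP[ar rb] B /nbhs_ballP[e /= e0 Be].
pose m := r - Num.min (e / 2) ((r - a) / 2).
have m0 : 0 < Num.min (e / 2) ((r - a) / 2).
  by rewrite lt_min !divr_gt0// subr_gt0.
have m1 : Num.min (e / 2) ((r - a) / 2) <= e / 2 by rewrite ge_min lexx.
have m2 : Num.min (e / 2) ((r - a) / 2) <= (r - a) / 2.
  by rewrite ge_min lexx orbT.
exists m; split; first by rewrite /m /=; apply/andP; split; lra.
by apply: Be; rewrite -ball_normE /= /m subKr gtr0_norm//; lra.
Qed.

Lemma cvg_exp {R : realType} {U : Type} (F : set_system U) {FF : Filter F}
    (f : U -> R) (a : R) n : f @ F --> a -> f z ^+ n @[z --> F] --> a ^+ n.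
Proof.
move=> fa; elim: n => [|n IH]; first exact: cvg_cst.
by rewrite exprS; under eq_fun do rewrite exprS; exact: cvgM.
Qed.

(** * Expansion of u over one time step, up to the boundary *)

Section derivs_taylor.
Context {R : realType} {d : nat}.
Implicit Types (t s : R) (x y : 'rV[R]_d).
Variables (T : R) (D A : set 'rV[R]_d).
Hypothesis oA : open A.
Hypothesis cA : convex_set A.
Hypothesis AD : A `<=` D.
Hypothesis DA : D `<=` closure A.
Variables (q : nat) (v : R -> 'rV[R]_d -> R).
Variable Dv : nat -> multi d -> R -> 'rV[R]_d -> R.
Hypothesis dvD : derivs q T D v Dv.

Let AI : A `<=` D°.
Proof. by move=> x Ax; apply: filterS AD _; exact: open_nbhs_nbhs. Qed.

Lemma derivs_within k l t : (2 * k + mlen l <= q)%N -> 0 <= t < T ->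
  {within D, continuous (Dv k l t)}.
Proof.
case: dvD => _ cD _ _ kl tT.
by apply: (within_slicel (cD k l kl)) => y Dy.
Qed.

Lemma derivs_within_time k l y : (2 * k + mlen l <= q)%N -> D y ->
  {within [set t | 0 <= t < T], continuous (Dv k l ^~ y)}.
Proof.
case: dvD => _ cD _ _ kl Dy.
by apply: (within_slicer (cD k l kl)) => t tT.
Qed.

Lemma convex_line x y (s : R) : A x -> A y -> 0 <= s <= 1 ->
  A (x + s *: (y - x)).
Proof.
move=> Ax Ay /andP[s0 s1].
rewrite (_ : x + _ = s *: y + (1 - s) *: x).
  by have := cA (Itv01 s0 s1) (mem_set Ay) (mem_set Ax); rewrite inE.
by apply/rowP => i; rewrite !mxE; ring.
Qed.

Variables (B : R) (K : nat).
Hypothesis B0 : 0 <= B.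
Hypothesis DvB : forall k l t y, (2 * k + mlen l <= q)%N -> 0 <= t < T -> D y ->
  `|Dv k l t y| <= B * weight y ^+ K.

Lemma derivs_space_taylor k n t x y :
  (2 * k + n <= q)%N -> 0 <= t < T -> D x -> D y ->
  `|Dv k m0 t y - \sum_(j < n) dirD (Dv k ^~ t) j m0 (y - x) x / j`!%:R|
    <= norm1 (y - x) ^+ n * (B * (weight x * weight y) ^+ K).
Proof.
move=> kn tT Dx Dy; rewrite -subr_le0.
pose F (z : 'rV[R]_d * 'rV[R]_d) : R := `|Dv k m0 t z.2 -
   \sum_(j < n) dirD (Dv k ^~ t) j m0 (z.2 - z.1) z.1 / j`!%:R|
   - norm1 (z.2 - z.1) ^+ n * (B * (weight z.1 * weight z.2) ^+ K).
suff : F (x, y) <= 0 by [].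
apply: (within_closure_le (A := [set z | A z.1 /\ A z.2])
   (D := [set z | D z.1 /\ D z.2])) => //.
- by move=> z [/AD ? /AD ?].
- exact: subset_closureX.
- apply/subspace_continuousP => -[x' y'] /= [Dx' Dy'].
  pose P2 : Type := ('rV[R]_d * 'rV[R]_d)%type.
  set z0 := (x', y'); set S := (X in within X _).
  have FF : Filter (within S (nbhs z0)) := within_filter _ (nbhs_filter z0).
  have cV m : (2 * k + mlen m <= q)%N ->
      (Dv k m t z.1 @[z --> within S (nbhs z0)] --> Dv k m t z0.1) /\
      (Dv k m t z.2 @[z --> within S (nbhs z0)] --> Dv k m t z0.2).
    move=> km; have cD := derivs_within km tT.
    have S0 : S z0 by [].
    have c1 : {within S, continuous (Dv k m t \o fst)}.
      by apply: within_comp cD => [z|z []//]; exact: cvg_fst.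
    have c2 : {within S, continuous (Dv k m t \o snd)}.
      by apply: within_comp cD => [z|z []//]; exact: cvg_snd.
    by move/subspace_continuousP : c1 => /(_ z0 S0) c1;
       move/subspace_continuousP : c2 => /(_ z0 S0) c2.
  have cx i : (fun z : P2 => z.1 0 i) @ within S (nbhs z0) --> z0.1 0 i.
    apply: cvg_within_filter; apply: (@continuous_comp _ _ _ fst (fun y => y 0 i)).
      exact: cvg_fst.
    exact: coord_continuous.
  have cy i : (fun z : P2 => z.2 0 i) @ within S (nbhs z0) --> z0.2 0 i.
    apply: cvg_within_filter; apply: (@continuous_comp _ _ _ snd (fun y => y 0 i)).
      exact: cvg_snd.
    exact: coord_continuous.
  have cd i : (fun z : P2 => (z.2 - z.1) 0 i) @ within S (nbhs z0)
      --> (z0.2 - z0.1) 0 i.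
    under eq_fun do rewrite !mxE.
    by rewrite !mxE; apply: cvgB.
  apply: cvgB; first (apply: cvg_norm; apply: cvgB).
  + have km : (2 * k + mlen (m0 : multi d) <= q)%N.
      by rewrite mlen_m0 addn0 (leq_trans _ kn)// leq_addr.
    exact: (cV _ km).2.
  + apply: (@cvg_big _ _ _ _ _ add_continuous) => j _; apply: cvgMr_tmp.
    apply: dirD_cvg => // m; rewrite mlen_m0 add0n => mj.
    have km : (2 * k + mlen m <= q)%N.
      by rewrite mj (leq_trans _ kn)// leq_add2l ltnW.
    exact: (cV _ km).1.
  + apply: cvgM; first apply: cvg_exp.
      by apply: (@cvg_big _ _ _ _ _ add_continuous) => j _; exact: cvg_norm.
    apply: cvgMl_tmp; apply: cvg_exp; apply: cvgM.
    * apply: cvgD; first exact: cvg_cst.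
      by apply: (@cvg_big _ _ _ _ _ add_continuous) => j _; exact: cvg_norm.
    * apply: cvgD; first exact: cvg_cst.
      by apply: (@cvg_big _ _ _ _ _ add_continuous) => j _; exact: cvg_norm.
move=> [x' y'] /= [Ax Ay]; rewrite /F /= subr_le0.
rewrite -[in Dv _ _ _ y'](subrKC x' y').
(* The k time derivatives have used 2k of the q orders. *)
apply: (dirD_taylor (V := Dv k ^~ t) (A := A) (q := q - 2 * k)) => //.
- move=> l i z lq Az; case: dvD => _ _ _; apply => //.
    by rewrite addnS -ltn_subRL.
  exact: AI.
- move=> l z lq Az; apply: (within_continuous_at oA AD) => //.
  apply: derivs_within => //; rewrite -leq_subRL//.
  by apply: leq_trans kn; rewrite leq_addr.
- by rewrite mlen_m0 add0n leq_subRL//; apply: leq_trans kn; rewrite leq_addr.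
- by move=> s; exact: convex_line.
move=> m s; rewrite mlen_m0 add0n => mn s01.
apply: le_trans (DvB _ tT _) _; rewrite ?mn//; first exact/AD/convex_line.
apply: ler_wpM2l => //; apply: lerXn2r; rewrite ?nnegrE ?mulr_ge0 ?weight_ge0//.
by have := weight_line x' (y' - x') s01; rewrite subrKC.
Qed.

(** Time derivatives exist only for 0 < t < T at interior points. The inequality is proved there,
    then extended to the points of [D], to initial time 0 and to final time T, where only the value
    of v enters. *)
Lemma derivs_time_taylor t t' x : (4 <= q)%N ->
  (forall y, D y -> {within [set t | 0 <= t <= T], continuous (v ^~ y)}) ->
  0 <= t -> t < t' <= T -> D x ->
  `|v t' x - v t x - (t' - t) * Dv 1%N m0 t x|
    <= (t' - t) ^+ 2 * (B * weight x ^+ K).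
Proof.
move=> q4 cv t0 tt' Dx; rewrite -subr_le0.
pose H (r r' : R) y : R := `|v r' y - v r y - (r' - r) * Dv 1%N m0 r y|
    - (r' - r) ^+ 2 * (B * weight y ^+ K).
have Dv0 r y : 0 <= r < T -> D y -> Dv 0%N m0 r y = v r y.
  by case: dvD => h _ _ _; exact: h.
have q1 : (2 * 1 + mlen (m0 : multi d) <= q)%N.
  by rewrite mlen_m0 (leq_trans _ q4).
have q0 : (2 * 0 + mlen (m0 : multi d) <= q)%N by rewrite mlen_m0.
have inA r r' y : 0 < r -> r < r' < T -> A y -> H r r' y <= 0.
  move=> r0 /andP[rr' r'T] Ay; rewrite subr_le0.
  have rsT s : 0 <= s <= 1 -> 0 < r + (r' - r) * s < T.
    move=> /andP[s0 s1]; apply/andP; split.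
      by rewrite ltr_wpDr// mulr_ge0// subr_ge0 ltW.
    rewrite (le_lt_trans _ r'T)// -lerBrDl ler_piMr// subr_ge0 ltW//.
  (* Time is rescaled to [0, 1]; the powers come from the chain rule. *)
  pose phi k s := (r' - r) ^+ k * Dv k m0 (r + (r' - r) * s) y.
  have := @taylor_bound R 2 phi ((r' - r) ^+ 2 * (B * weight y ^+ K)).
  move=> /(_ _ _ 1); rewrite ler01 lexx => /(_ _ _ isT).
  rewrite !big_ord_recr big_ord0 /= /phi !expr0 !mul1r !mulr1 !mulr0 !addr0.
  rewrite add0r !expr1 !fact0 !divr1 subrKC opprD addrA.
  rewrite (Dv0 r y) ?(Dv0 r' y) ?(ltW r0) ?(lt_trans rr') ?(ltW (lt_trans r0 rr'))//;
    try exact: AD.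
  apply.
  - move=> k s k2 s01; rewrite /phi exprSr.
    have kq : (2 * k.+1 + mlen (m0 : multi d) <= q)%N.
      by rewrite mlen_m0 addn0 (leq_trans _ q4)// (leq_mul2l 2 _ 2).
    case: dvD => _ _ dt _.
    have d1 := dt k m0 _ y kq (rsT s s01) (AI Ay).
    have d2 : is_derive s 1 (fun s => r + (r' - r) * s) (r' - r).
      have := @is_deriveD R R R (cst r) ((r' - r) \*: id) s 1 0 ((r' - r) * 1)
        (is_derive_cst r s 1) (is_deriveZ (r' - r) (is_derive_id s 1)).
      by rewrite add0r mulr1.
    have := is_deriveZ ((r' - r) ^+ k) (@is_derive1_comp _ (Dv k m0 ^~ y)
      (fun s => r + (r' - r) * s) s _ _ d1 d2).
    by rewrite /GRing.scale /= mulrA mulrAC.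
  - move=> s s01; rewrite normrM ger0_norm ?exprn_ge0 ?subr_ge0 ?(ltW rr')//.
    rewrite ler_wpM2l ?exprn_ge0 ?subr_ge0 ?(ltW rr')//.
    apply: DvB; [by rewrite mlen_m0|  |exact: AD].
    by have /andP[/ltW-> ->] := rsT s s01.
(* Limit in space at fixed times. *)
have inD r r' y : 0 < r -> r < r' < T -> D y -> H r r' y <= 0.
  move=> r0 rr' Dy.
  apply: (within_closure_le AD DA (F := H r r')) => //; last first.
    by move=> z Az; exact: inA.
  have cvD s : 0 <= s < T -> {within D, continuous (v s)}.
    move=> sT; apply: subspace_eq_continuous (derivs_within q0 sT) => z.
    by rewrite inE => Dz; exact: Dv0.
  have /andP[rr'1 r'T] := rr'.
  have rT : 0 <= r < T by rewrite (ltW r0) (lt_trans rr'1).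
  have r'T' : 0 <= r' < T by rewrite (ltW (lt_trans r0 rr'1)).
  move: (cvD _ rT) (cvD _ r'T') (derivs_within q1 rT).
  move=> /subspace_continuousP c1 /subspace_continuousP c2.
  move=> /subspace_continuousP c3; apply/subspace_continuousP => z Dz.
  apply: cvgB; first (apply: cvg_norm; apply: cvgB; first apply: cvgB).
  - exact: c2.
  - exact: c1.
  - by apply: cvgMl_tmp; exact: c3.
  apply: cvgMl_tmp; apply: cvgMl_tmp; apply: cvg_exp; apply: cvgD.
    exact: cvg_cst.
  apply: (@cvg_big _ _ _ _ _ add_continuous) => j _; apply: cvg_norm.
  by apply: cvg_within_filter; exact: coord_continuous.
(* Limit in the initial time, down to 0. *)
have inD0 r' y : 0 < r' < T -> D y -> forall r, 0 <= r < r' -> H r r' y <= 0.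
  move=> /andP[r'0 r'T] Dy.
  apply: (within_closure_le (A := [set r | 0 < r < r'])
     (D := [set r | 0 <= r < r']) (F := fun r => H r r' y)).
  - by move=> r /= /andP[/ltW -> ->].
  - exact: closure_itv_left.
  - have c1 : {within [set r | 0 <= r < r'], continuous (v ^~ y)}.
      apply: continuous_subspaceW (cv y Dy) => r /= /andP[-> rr'].
      by rewrite (ltW (lt_trans rr' r'T)).
    have c3 : {within [set r | 0 <= r < r'], continuous (Dv 1%N m0 ^~ y)}.
      apply: continuous_subspaceW (derivs_within_time q1 Dy) => r /= /andP[-> rr'].
      by rewrite (lt_trans rr' r'T).
    move: c1 c3 => /subspace_continuousP c1 /subspace_continuousP c3.
    apply/subspace_continuousP => z zr.
    have cz : r @[r --> within [set r | 0 <= r < r'] (nbhs z)] --> z.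
      exact: cvg_within.
    have cd : r' - r @[r --> within [set r | 0 <= r < r'] (nbhs z)] --> r' - z.
      by apply: cvgB => //; exact: cvg_cst.
    apply: cvgB; first (apply: cvg_norm; apply: cvgB; first apply: cvgB).
    + exact: cvg_cst.
    + exact: c1.
    + by apply: cvgM => //; exact: c3.
    by apply: cvgMr_tmp; exact: cvg_exp.
  - by move=> r /= /andP[r0 rr']; apply: inD => //; rewrite rr'.
have /andP[tt'1 t'T] := tt'.
(* Limit in the final time, up to T, using continuity of v on the closed time interval. *)
apply: (within_closure_le (A := [set s | t < s < T])
     (D := [set s | t < s <= T]) (F := fun s => H t s x)) => //.
- by move=> r /= /andP[-> /ltW ->].
- by exact: closure_itv_right.
- have c1 : {within [set s | t < s <= T], continuous (v ^~ x)}.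
    apply: continuous_subspaceW (cv x Dx) => r /= /andP[tr ->].
    by rewrite (ltW (le_lt_trans t0 tr)).
  move: c1 => /subspace_continuousP c1.
  apply/subspace_continuousP => z zr.
  have cd : s - t @[s --> within [set s | t < s <= T] (nbhs z)] --> z - t.
    by apply: cvgB; [exact: cvg_within|exact: cvg_cst].
  apply: cvgB; first (apply: cvg_norm; apply: cvgB; first apply: cvgB).
  + exact: c1.
  + exact: cvg_cst.
  + exact: cvgMr_tmp.
  by apply: cvgMr_tmp; exact: cvg_exp.
- move=> r /= /andP[tr rT]; apply: inD0 => //; last by rewrite t0.
  by rewrite (le_lt_trans t0 tr).
Qed.

(** The bound on [Dv] stops short of T; the value at T is a limit of values at earlier times. *)
Lemma derivs_growth t y : (0 < T) ->
  {within [set t | 0 <= t <= T], continuous (v ^~ y)} ->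
  0 <= t <= T -> D y -> `|v t y| <= B * weight y ^+ K.
Proof.
move=> T0 cv tT Dy.
have q0 : (2 * 0 + mlen (m0 : multi d) <= q)%N by rewrite mlen_m0.
have lt s : 0 <= s < T -> `|v s y| <= B * weight y ^+ K.
  by move=> sT; case: dvD => h _ _ _; rewrite -h//; exact: DvB.
move: tT => /andP[t0]; rewrite le_eqVlt => /predU1P[->|tT]; last first.
  by apply: lt; rewrite t0.
apply: (within_closure_le (A := [set s | 0 < s < T])
     (D := [set s | 0 < s <= T]) (F := fun s => `|v s y|)).
- by move=> r /= /andP[-> /ltW ->].
- exact: closure_itv_right.
- apply: (@within_continuous_comp R R R _ (v ^~ y) (fun z => `|z|)).
    by move=> z _; exact: norm_continuous.
  by apply: continuous_subspaceW cv => r /= /andP[/ltW -> ->].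
- by move=> s /= /andP[/ltW s0 sT]; apply: lt; rewrite s0.
- by rewrite /= T0 lexx.
Qed.

(** With the time step taken at y, both space expansions are made at the single time t < T: u to
    fourth order and d_t u, already multiplied by t' - t, to second order. *)
Lemma derivs_step_expansion t t' x y : (4 <= q)%N ->
  (forall y, D y -> {within [set t | 0 <= t <= T], continuous (v ^~ y)}) ->
  0 <= t -> t < t' <= T -> D x -> D y ->
  `|v t' y - v t x - ((t' - t) * Dv 1%N m0 t x
     + dirD (Dv 0%N ^~ t) 1 m0 (y - x) x
     + dirD (Dv 0%N ^~ t) 2 m0 (y - x) x / 2
     + dirD (Dv 0%N ^~ t) 3 m0 (y - x) x / 6
     + (t' - t) * dirD (Dv 1%N ^~ t) 1 m0 (y - x) x)|
  <= B * (weight x * weight y) ^+ K *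
     ((t' - t) ^+ 2 + (t' - t) * norm1 (y - x) ^+ 2 + norm1 (y - x) ^+ 4).
Proof.
move=> q4 cv t0 tt' Dx Dy; have /andP[tt'1 t'T] := tt'.
have tT : 0 <= t < T by rewrite t0 (lt_le_trans tt'1).
have h0 : 0 < t' - t by rewrite subr_gt0.
have e1 := derivs_time_taylor q4 cv t0 tt' Dy.
have e2 := @derivs_space_taylor 1 2 t x y q4 tT Dx Dy.
have e3 := @derivs_space_taylor 0 4 t x y q4 tT Dx Dy.
have Dv0 z : D z -> Dv 0%N m0 t z = v t z.
  by move=> Dz; case: dvD => h _ _ _; exact: h.
have [f1 f2 f3] : [/\ 1`! = 1%N, 2`! = 2%N & 3`! = 6%N] by [].
rewrite !big_ord_recr big_ord0 /= add0r fact0 f1 !divr1 in e2.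
rewrite !big_ord_recr big_ord0 /= add0r !Dv0// fact0 f1 f2 f3 !divr1 in e3.
set W := B * (weight x * weight y) ^+ K in e2 e3 *.
set d0 := dirD (Dv 1%N ^~ t) 1 _ _ _; set d1 := dirD (Dv 0%N ^~ t) 1 _ _ _.
set d2 := dirD (Dv 0%N ^~ t) 2 _ _ _; set d3 := dirD (Dv 0%N ^~ t) 3 _ _ _.
have {}e2 : `|Dv 1%N m0 t y - (Dv 1%N m0 t x + d0)| <= norm1 (y - x) ^+ 2 * W.
  exact: e2.
have {}e3 : `|v t y - (v t x + d1 + d2 / 2 + d3 / 6)| <= norm1 (y - x) ^+ 4 * W.
  exact: e3.
have {}e1 : `|v t' y - v t y - (t' - t) * Dv 1%N m0 t y| <= (t' - t) ^+ 2 * W.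
  apply: le_trans e1 _; rewrite ler_wpM2l ?exprn_ge0 ?(ltW h0)// ler_wpM2l//.
  by rewrite lerXn2r ?nnegrE ?mulr_ge0 ?weight_ge0// ler_peMl ?weight_ge1 ?weight_ge0.
(* Three errors: the time step at y, the move of d_t v from y to x, and the move of v from y to x at
   time t. *)
rewrite [leLHS](_ : _ = `|(v t' y - v t y - (t' - t) * Dv 1%N m0 t y)
  + (t' - t) * (Dv 1%N m0 t y - (Dv 1%N m0 t x + d0))
  + (v t y - (v t x + d1 + d2 / 2 + d3 / 6))|); last by congr `|_|; ring.
rewrite (le_trans (ler_normD _ _))// (le_trans (lerD (ler_normD _ _) (lexx _)))//.
rewrite [leRHS](_ : _ = (t' - t) ^+ 2 * W
  + (t' - t) * (norm1 (y - x) ^+ 2 * W) + norm1 (y - x) ^+ 4 * W); last by ring.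
apply: lerD; first apply: lerD => //.
- by rewrite normrM gtr0_norm// ler_pM2l.
- exact: e3.
Qed.

End derivs_taylor.

(** * The PDE for the derivatives that grow polynomially *)

Section classical_pde.
Context {R : realType} {d : nat}.
Implicit Types (t s : R) (x y : 'rV[R]_d).
Variables (T : R) (D A : set 'rV[R]_d).
Hypothesis oA : open A.
Hypothesis AD : A `<=` D.
Hypothesis DA : D `<=` closure A.

Let AI : A `<=` D°.
Proof. by move=> x Ax; apply: filterS AD _; exact: open_nbhs_nbhs. Qed.

Variable v : R -> 'rV[R]_d -> R.

(** Equality climbs one order at a time: interior derivatives of equal functions agree, and both
    extensions to the boundary are continuous. *)
Lemma derivs_space_unique p q (Dv Dw : nat -> multi d -> R -> 'rV[R]_d -> R)
    l i t y : derivs p T D v Dv -> derivs q T D v Dw ->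
  ((mlen l).+1 <= p)%N -> ((mlen l).+1 <= q)%N -> 0 <= t < T ->
  (forall y, D y -> Dv 0%N l t y = Dw 0%N l t y) -> D y ->
  Dv 0%N (madd1 l i) t y = Dw 0%N (madd1 l i) t y.
Proof.
move=> dv dw lp lq tT E Dy.
apply: (within_closure_eq AD DA (F := Dv 0%N (madd1 l i) t)
  (G := Dw 0%N (madd1 l i) t)) => //.
- by apply: (derivs_within dv _ tT); rewrite mlen_madd1.
- by apply: (derivs_within dw _ tT); rewrite mlen_madd1.
move=> x Ax.
have h1 : is_derive x (delta_mx 0 i) (Dv 0%N l t) (Dv 0%N (madd1 l i) t x).
  by case: dv => _ _ _; apply => //; exact: AI.
have h2 : is_derive x (delta_mx 0 i) (Dw 0%N l t) (Dw 0%N (madd1 l i) t x).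
  by case: dw => _ _ _; apply => //; exact: AI.
have [_ <-] := h1; have [_ <-] := h2; apply: near_eq_derive.
by apply: filterS (AI Ax) => z Dz; exact: E.
Qed.

Lemma derivs_time_unique p q (Dv Dw : nat -> multi d -> R -> 'rV[R]_d -> R) t y :
  derivs p T D v Dv -> derivs q T D v Dw ->
  (2 <= p)%N -> (2 <= q)%N -> 0 <= t < T -> D y ->
  Dv 1%N m0 t y = Dw 1%N m0 t y.
Proof.
move=> dv dw p2 q2 /[dup] tT /andP[t0 tT1] Dy.
have p1 : (2 * 1 + mlen (m0 : multi d) <= p)%N by rewrite mlen_m0.
have q1 : (2 * 1 + mlen (m0 : multi d) <= q)%N by rewrite mlen_m0.
(* Time derivatives are prescribed only for positive times, so t = 0 is reached by continuity. *)
suff inner s : 0 < s < T -> Dv 1%N m0 s y = Dw 1%N m0 s y.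
  apply: (within_closure_eq (A := [set s | 0 < s < T])
     (D := [set s | 0 <= s < T]) (F := Dv 1%N m0 ^~ y) (G := Dw 1%N m0 ^~ y)) => //.
  - by move=> r /= /andP[/ltW -> ->].
  - exact: closure_itv_left.
  - exact: (derivs_within_time dv p1 Dy).
  - exact: (derivs_within_time dw q1 Dy).
move=> /[dup] sT /andP[s0 sT1].
have sT' : 0 <= s < T by rewrite ltW.
apply: (within_closure_eq AD DA (F := Dv 1%N m0 s) (G := Dw 1%N m0 s)) => //.
- exact: (derivs_within dv p1 sT').
- exact: (derivs_within dw q1 sT').
move=> x Ax.
have h1 : is_derive s 1 (Dv 0%N m0 ^~ x) (Dv 1%N m0 s x).
  by case: dv => _ _ + _; apply => //; exact: AI.
have h2 : is_derive s 1 (Dw 0%N m0 ^~ x) (Dw 1%N m0 s x).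
  by case: dw => _ _ + _; apply => //; exact: AI.
have [_ <-] := h1; have [_ <-] := h2; apply: near_eq_derive.
have : \forall r \near s, r \in `]0, T[.
  by apply: near_in_itvoo; rewrite in_itv.
apply: filterS => r; rewrite in_itv /= => /andP[r0 rT].
have rT' : 0 <= r < T by rewrite ltW.
by case: dv => hv _ _ _; case: dw => hw _ _ _; rewrite hv ?hw//; exact: AD.
Qed.

Lemma classical_solution_derivs q (b : 'rV[R]_d -> 'rV[R]_d) (a : 'rV[R]_d -> 'M[R]_d)
    f (Dv : nat -> multi d -> R -> 'rV[R]_d -> R) t y : (2 <= q)%N ->
  classical_solution T D b a f v -> derivs q T D v Dv -> 0 <= t < T -> D y ->
  Dv 1%N m0 t y
  + 2^-1 * (\sum_i \sum_j a y i j * Dv 0%N (madd1 (madd1 m0 i) j) t y)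
  + \sum_i b y 0 i * Dv 0%N (madd1 m0 i) t y = 0.
Proof.
move=> q2 [_ _ [Dw [dw pde]]] dv tT Dy; rewrite -[RHS](pde t y tT Dy).
have e0 z : D z -> Dv 0%N m0 t z = Dw 0%N m0 t z.
  by move=> Dz; case: dv => hv _ _ _; case: dw => hw _ _ _; rewrite hv ?hw.
have e1 i z : D z -> Dv 0%N (madd1 m0 i) t z = Dw 0%N (madd1 m0 i) t z.
  move=> Dz; apply: (@derivs_space_unique q 2 Dv Dw m0 i t z dv dw _ _ tT e0 Dz).
    by rewrite mlen_m0 (leq_trans _ q2).
  by rewrite mlen_m0.
have e2 i j z : D z -> Dv 0%N (madd1 (madd1 m0 i) j) t z
    = Dw 0%N (madd1 (madd1 m0 i) j) t z.
  have e1i x : D x -> Dv 0%N (madd1 m0 i) t x = Dw 0%N (madd1 m0 i) t x := @e1 i x.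
  move=> Dz.
  apply: (@derivs_space_unique q 2 Dv Dw _ j t z dv dw _ _ tT e1i Dz).
    by rewrite mlen_madd1 mlen_m0.
  by rewrite mlen_madd1 mlen_m0.
rewrite (derivs_time_unique dv dw)//; congr (_ + _ * _ + _); last first.
  by apply: eq_bigr => i _; rewrite e1.
(* The trace pairs the entry (i, j) of a with the entry (j, i) of the Hessian; the multi-indices
   agree by [madd1C]. *)
rewrite /mxtrace; apply: eq_bigr => i _; rewrite mxE; apply: eq_bigr => j _.
by rewrite mxE madd1C e2.
Qed.

End classical_pde.

(** * Measurability and conditional expectations *)

Section vector_measurability.
Context {R : realType} {d : nat} {dO : measure_display} {O : measurableType dO}.
Variable X : O -> 'rV[R]_d.
Hypothesis mX : forall i, measurable_fun setT (fun w => X w 0 i).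

Lemma measurable_rational_box (q : 'rV[rat]_d) (r : rat) :
  measurable [set w | forall i, `|X w 0 i - ratr (q 0 i)| < ratr r].
Proof.
rewrite (_ : mkset _ = ~` \bigcup_i ~` [set w | `|X w 0 i - ratr (q 0 i)| < ratr r]).
  apply/measurableC/countable_bigcupT_measurable; first exact: countableP.
  move=> i; apply: measurableC; rewrite -[X in measurable X]setTI.
  have m1 : measurable_fun setT (fun w => `|X w 0 i - ratr (q 0 i)|).
    by apply: measurableT_comp => //; apply: measurable_funB.
  have := m1 measurableT `]-oo, ratr r[%classic (measurable_itv _).
  by congr measurable; apply/seteqP; split => w /=; rewrite in_itv.
apply/seteqP; split => w /= h.
  by move=> [i _] /=; apply.
by move=> i; apply: contrapT => hi; apply: h; exists i.
Qed.

(** Measurability is given coordinate by coordinate; an open set is the union of the countably many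
    rational cubes it contains. *)
Lemma measurable_preimage_open (U : set 'rV[R]_d) :
  open U -> measurable (X @^-1` U).
Proof.
move=> oU.
pose box (p : 'rV[rat]_d * rat) :=
  [set x : 'rV[R]_d | forall i, `|x 0 i - ratr (p.1 0 i)| < ratr p.2].
pose F p := if `[< box p `<=` U >] then X @^-1` box p else set0.
rewrite (_ : _ @^-1` _ = \bigcup_p F p).
  apply: countable_bigcupT_measurable; first exact: countableP.
  by move=> p; rewrite /F; case: ifPn => // _; exact: measurable_rational_box.
apply/seteqP; split => w /=; last first.
  by move=> [p _]; rewrite /F; case: ifPn => // /asboolP bU; exact: bU.
move=> Uw; have /nbhs_ballP[e /= e0 eU] : nbhs (X w) U by exact: open_nbhs_nbhs.
(* Two points of a cube of radius r differ by less than 2r < e in each coordinate. *)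
have /rat_in_itvoo[r] : 0 < e / 2 by rewrite divr_gt0.
rewrite in_itv /= => /andP[r0 re].
have ex i : exists q : rat, `|X w 0 i - ratr q| < ratr r.
  have /rat_in_itvoo[q] : X w 0 i - ratr r < X w 0 i + ratr r by lra.
  by rewrite in_itv /= => /andP[q1 q2]; exists q; rewrite ltr_norml; lra.
have [q hq] := choice ex.
exists (\row_i q i, r) => //; rewrite /F asboolT /=.
  by move=> i /=; rewrite mxE; exact: hq.
move=> y hy; apply: eU; split => // i j.
rewrite (ord1 i) -ball_normE /=.
have := hy j; rewrite /= mxE => h1; have h2 := hq j.
rewrite (_ : _ - _ = (X w 0 j - ratr (q j)) - (y 0 j - ratr (q j))); last by ring.
by rewrite (le_lt_trans (ler_normB _ _))//; lra.
Qed.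

(** The set where g > a is the trace on [D] of an open set, and X takes its values in [D], so the
    preimage is that of the open set. *)
Lemma measurable_comp_within (D : set 'rV[R]_d) (g : 'rV[R]_d -> R) :
  {within D, continuous g} -> (forall w, D (X w)) ->
  measurable_fun setT (fun w => g (X w)).
Proof.
move=> cg DX; apply: (measurability _ (RGenOInfty.measurableE R)).
move=> _ [_ [a ->] <-]; rewrite setTI.
have /continuousP/(_ `]a, +oo[%classic) := cg.
have oa : open (`]a, +oo[%classic : set R) by apply: interval_open.
move=> /(_ oa) /open_subspaceP[V oV VD].
rewrite (_ : _ @^-1` _ = X @^-1` V); first exact: measurable_preimage_open.
apply/seteqP; split => w /= h.
  have : (V `&` D) (X w) by rewrite VD; split => //; exact: DX.
  by case.
have : ((g @^-1` `]a, +oo[%classic) `&` D) (X w) by rewrite -VD; split.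
by case.
Qed.

End vector_measurability.

(** * Pulling a factor out of a conditional expectation *)

Section pull_out.
Context {R : realType} {dO : measure_display} {O : measurableType dO}.
Variable P : probability O R.
Variable GG : set (set O).
Hypothesis GGm : GG `<=` measurable.
Local Notation OG := (g_sigma_algebraType GG).

Lemma g_sigma_algebra_measurable (A : set O) :
  measurable (A : set OG) -> measurable A.
Proof.
have sub : <<s GG>> `<=` @measurable _ O.
  by apply: smallest_sub => //; exact: sigma_algebra_measurable.
exact: sub.
Qed.

Lemma g_sigma_algebra_measurable_fun (f : O -> R) :
  measurable_fun setT (f : OG -> R) -> measurable_fun setT f.
Proof. by move=> mf _ B mB; apply: g_sigma_algebra_measurable; exact: mf. Qed.

Lemma meas_wrtP (f : O -> R) :
  meas_wrt <<s GG>> f <-> measurable_fun setT (f : OG -> R).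
Proof.
split => [mf _ B mB|mf B mB]; first by rewrite setTI; exact: mf.
by have := mf measurableT B mB; rewrite setTI.
Qed.

Import HBNNSimple.

Lemma integral_mul_nnsfun0 (U : O -> R) (g : {nnsfun OG >-> R}) :
  P.-integrable setT (EFin \o U) ->
  (forall A, measurable (A : set OG) -> \int[P]_(w in A) (U w)%:E = 0)%E ->
  (\int[P]_w (g w * U w)%:E = 0)%E.
Proof.
move=> iU U0.
have mg y : measurable ((g @^-1` [set y]) : set OG).
  by rewrite -[X in measurable X]setTI; exact: measurable_funP.
have E w : (g w * U w)%:E = (\sum_(y <- finmap.enum_fset (fset_set (range g)))
    y%:E * (EFin \o U) \_ (g @^-1` [set y]) w)%E.
  rewrite [in LHS](fimfunE g) fsbig_finite//= mulr_suml -sumEFin.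
  apply: eq_bigr => y _; rewrite -mulrA EFinM; congr (_ * _)%E.
  by rewrite patchE indicE; case: ifPn => _; rewrite ?mul1r ?mul0r.
under eq_integral do rewrite E.
have iR y : P.-integrable setT ((EFin \o U) \_ (g @^-1` [set y])).
  apply: (integrable_mkcond (EFin \o U) (g_sigma_algebra_measurable (mg y))).1.
  apply: (@integrableS _ _ _ P setT _ _ measurableT _ _ iU) => //.
  exact: g_sigma_algebra_measurable.
rewrite integral_sum//; last by move=> y; exact: integrableZl.
apply: big1 => y _; rewrite integralZl// -integral_mkcond/=.
by rewrite U0// mule0.
Qed.

(** Dominated convergence: the simple functions increase to f, hence their products with U are
    dominated by |f U|. *)
Lemma integral_mul_ge0_eq0 (U f : O -> R) :
  P.-integrable setT (EFin \o U) ->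
  (forall A, measurable (A : set OG) -> \int[P]_(w in A) (U w)%:E = 0)%E ->
  measurable_fun setT (f : OG -> R) -> (forall w, 0 <= f w) ->
  P.-integrable setT (fun w => (f w * U w)%:E) ->
  (\int[P]_w (f w * U w)%:E = 0)%E.
Proof.
move=> iU U0 mf f0 ifU.
have mfE : measurable_fun setT (EFin \o f : OG -> \bar R).
  exact/measurable_EFinP.
pose g := nnsfun_approx measurableT mfE.
have f0' x : setT x -> (0 <= (EFin \o f) x)%E by rewrite lee_fin.
have gf k w : g k w <= f w.
  by rewrite -lee_fin /g nnsfun_approxE; exact: le_approx.
have mU : measurable_fun setT U by case/integrableP : iU => /measurable_EFinP.
have mg k : measurable_fun setT (g k : O -> R).
  apply: g_sigma_algebra_measurable_fun; exact: measurable_funPT.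
have h1 k : measurable_fun setT (fun w : O => (g k w * U w)%:E).
  by apply/measurable_EFinP/measurable_funM.
have h2 : measurable_fun setT (fun w : O => (f w * U w)%:E).
  apply/measurable_EFinP/measurable_funM => //.
  exact: g_sigma_algebra_measurable_fun.
have h3 : {ae P, forall w : O, setT w ->
    (g k w * U w)%:E @[k --> \oo] --> (f w * U w)%:E}.
  apply: aeW => w _.
  have : (g k w)%:E @[k --> \oo] --> (f w)%:E by exact: cvg_nnsfun_approx.
  move=> /fine_cvgP[_ cg].
  by apply: cvg_EFin; [exact: nearW|apply: cvgMr_tmp].
have h4 : {ae P, forall (w : O) k, setT w ->
    (`|(g k w * U w)%:E| <= `|(f w * U w)%:E|)%E}.
  by apply: aeW => w k _ /=; rewrite lee_fin !normrM ler_wpM2r// !ger0_norm.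
have [_ _ c] := @dominated_convergence _ O R P setT measurableT
  _ _ _ h1 h2 h3 (integrable_abse ifU) h4.
have c0 : (\int[P]_w (g k w * U w)%:E @[k --> \oo] --> 0)%E.
  under eq_fun do rewrite (integral_mul_nnsfun0 _ iU U0); exact: cvg_cst.
exact: (cvg_unique _ c c0).
Qed.

Lemma integral_mul_eq0 (U f : O -> R) :
  P.-integrable setT (EFin \o U) ->
  (forall A, measurable (A : set OG) -> \int[P]_(w in A) (U w)%:E = 0)%E ->
  measurable_fun setT (f : OG -> R) ->
  P.-integrable setT (fun w => (f w * U w)%:E) ->
  (\int[P]_w (f w * U w)%:E = 0)%E.
Proof.
move=> iU U0 mf ifU.
have mU : measurable_fun setT U by case/integrableP : iU => /measurable_EFinP.
have i1 : P.-integrable setT (fun w => (f^\+ w * U w)%:E).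
  apply: le_integrable ifU => //.
    apply/measurable_EFinP/measurable_funM => //.
    exact/measurable_funrpos/g_sigma_algebra_measurable_fun.
  move=> w _ /=; rewrite lee_fin !normrM ler_wpM2r// ger0_norm ?funrpos_ge0//.
  by rewrite /funrpos ge_max ler_norm normr_ge0.
have i2 : P.-integrable setT (fun w => (f^\- w * U w)%:E).
  apply: le_integrable ifU => //.
    apply/measurable_EFinP/measurable_funM => //.
    exact/measurable_funrneg/g_sigma_algebra_measurable_fun.
  move=> w _ /=; rewrite lee_fin !normrM ler_wpM2r// ger0_norm ?funrneg_ge0//.
  by rewrite /funrneg ge_max -normrN ler_norm normr_ge0.
rewrite (eq_integral (fun w => ((f^\+ w * U w)%:E - (f^\- w * U w)%:E)%E)); last first.
  move=> w _; rewrite -EFinB -mulrBl; congr (_ * _)%:E.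
  rewrite /funrpos /funrneg !maxEle /=.
  by do 2 case: ifPn; rewrite -?ltNge; lra.
rewrite integralB_EFin//.
rewrite (integral_mul_ge0_eq0 iU U0 _ _ i1) ?(integral_mul_ge0_eq0 iU U0 _ _ i2) ?sube0//.
- exact: measurable_funrneg.
- exact: measurable_funrpos.
Qed.

(* Integrability of f V passes to f Z by testing against min(|f|, k) sgn Z and
   letting k tend to infinity; the diffusion matrix, about which no growth is
   assumed, enters only through such a Z. *)
Lemma is_cexp_pull (V Z f : O -> R) :
  is_cexp P <<s GG>> V Z -> meas_wrt <<s GG>> f ->
  P.-integrable setT (fun w => (f w * V w)%:E) ->
  P.-integrable setT (fun w => (f w * Z w)%:E) /\
  (\int[P]_w (f w * Z w)%:E = \int[P]_w (f w * V w)%:E)%E.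
Proof.
move=> [iV iZ /meas_wrtP mZ VZ] /meas_wrtP mf ifV.
have mVO : measurable_fun setT V by case/integrableP : iV => /measurable_EFinP.
have mZO : measurable_fun setT Z by exact: g_sigma_algebra_measurable_fun.
have mfO : measurable_fun setT f by exact: g_sigma_algebra_measurable_fun.
pose U w := V w - Z w.
have iU : P.-integrable setT (EFin \o U).
  by rewrite (_ : _ \o _ = (EFin \o V) \- (EFin \o Z))%E//; exact: integrableB.
have U0 A : measurable (A : set OG) -> (\int[P]_(w in A) (U w)%:E = 0)%E.
  move=> mA; have mAO := g_sigma_algebra_measurable mA.
  have iVA : P.-integrable A (EFin \o V) by apply: integrableS iV.
  have iZA : P.-integrable A (EFin \o Z) by apply: integrableS iZ.
  under eq_integral do rewrite EFinB.
  rewrite integralB_EFin// VZ// subee//.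
  exact: integrable_fin_num iVA.
have ifZ : P.-integrable setT (fun w => (f w * Z w)%:E).
  pose m k w : R := Num.min `|f w| k%:R.
  have m0 k w : 0 <= m k w by rewrite /m le_min normr_ge0 ler0n.
  (* The sign of Z, with value 1 at 0, so that s Z = |Z|. *)
  pose s w : R := \1_[set w | 0 <= Z w] w - \1_[set w | Z w < 0] w.
  have sZ w : s w * Z w = `|Z w|.
    rewrite /s !indicE; have [Z0|Z0] := leP 0 (Z w).
      by rewrite mem_set// memNset ?subr0 ?mul1r ?ger0_norm//= ltNge Z0.
    by rewrite memNset ?mem_set//= ?sub0r ?mulN1r ?ltr0_norm//= leNgt Z0.
  have s1 w : `|s w| <= 1.
    rewrite /s !indicE; have [Z0|Z0] := leP 0 (Z w).
      by rewrite mem_set// memNset ?subr0 ?normr1//= ltNge Z0.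
    by rewrite memNset ?mem_set//= ?sub0r ?normrN1//= leNgt Z0.
  have mm k : measurable_fun (setT : set OG) (m k).
    by apply: measurable_minr => //; exact: measurableT_comp.
  have ms : measurable_fun (setT : set OG) s.
    apply: measurable_funB; apply: measurable_indic.
      rewrite -[X in measurable X]setTI -preimage_itvcy; exact: mZ.
    rewrite -[X in measurable X]setTI -preimage_itvNyo; exact: mZ.
  have mms k : measurable_fun (setT : set OG) (fun w => m k w * s w).
    exact: measurable_funM.
  have bms k w : `|m k w * s w| <= k%:R.
    rewrite normrM (ger0_norm (m0 _ _)) -[leRHS]mulr1 ler_pM//.
    by rewrite /m ge_min lexx orbT.
  have ib (h : O -> R) k : P.-integrable setT (EFin \o h) ->
      P.-integrable setT (fun w => (m k w * s w * h w)%:E).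
    move=> ih; have mh : measurable_fun setT h.
      by case/integrableP : ih => /measurable_EFinP.
    apply: (@le_integrable _ _ _ P setT measurableT _ (fun w => k%:R%:E * (h w)%:E)%E).
    - apply/measurable_EFinP/measurable_funM => //.
      exact: g_sigma_algebra_measurable_fun.
    - move=> w _; rewrite /= lee_fin !normrM ler_wpM2r//.
      by rewrite -normrM (le_trans (bms k w))// ler_norm.
    - exact: integrableZl.
  (* The bounded factor m s may be moved from Z to V, and m <= |f|; the bound does not depend on
     k. *)
  have E k : (\int[P]_w (m k w * `|Z w|)%:E <= \int[P]_w `|(f w * V w)%:E|)%E.
    under eq_integral do rewrite -sZ mulrA.
    have : (\int[P]_w ((m k w * s w * V w)%:E - (m k w * s w * Z w)%:E) = 0)%E.
      rewrite -[RHS](integral_mul_eq0 iU U0 (mms k) (ib _ k iU)).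
      by apply: eq_integral => w _; rewrite -EFinB -mulrBr.
    have iZk := ib _ k iZ; have iVk := ib _ k iV.
    rewrite integralB_EFin// => /eqP.
    rewrite sube_eq//; last exact: integrable_fin_num iVk.
    rewrite add0e => /eqP <-.
    apply: le_integral => //; first exact: integrable_abse.
    move=> w _; rewrite lee_fin (le_trans (ler_norm _))// !normrM ler_wpM2r//.
    rewrite (ger0_norm (m0 _ _)) -[leRHS]mulr1 ler_pM//.
    by rewrite /m ge_min lexx.
  apply/integrableP; split; first exact/measurable_EFinP/measurable_funM.
  have /integrableP[_] := ifV; apply: le_lt_trans.
  (* Monotone convergence; at each point the truncation is inactive once k >= |f w|. *)
  have c : (\int[P]_w (m k w * `|Z w|)%:E @[k --> \oo]
      --> \int[P]_w `|(f w * Z w)%:E|)%E.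
    rewrite (eq_integral (fun w => limn (fun k => (m k w * `|Z w|)%:E))).
      apply: (@cvg_monotone_convergence _ O R P setT measurableT
        (fun k w => (m k w * `|Z w|)%:E)).
      + move=> k; apply/measurable_EFinP/measurable_funM.
          exact: g_sigma_algebra_measurable_fun.
        exact: measurableT_comp.
      + by move=> k w _; rewrite lee_fin mulr_ge0.
      + move=> w _ a b ab; rewrite lee_fin ler_wpM2r//.
        by rewrite /m le_min ge_min lexx /= ge_min ler_nat ab orbT.
    move=> w _; apply/esym/cvg_lim => //.
    apply: cvg_near_cst; near=> k.
    rewrite abse_EFin normrM /m min_l//.
    by near: k; exact: nbhs_infty_ger.
  by apply: (cvge_to_le c); apply: nearW.
split => //.
have ifU : P.-integrable setT (fun w => (f w * U w)%:E).
  rewrite (_ : (fun _ => _) = (fun w => (f w * V w)%:E - (f w * Z w)%:E)%E).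
    exact: integrableB.
  by apply/funext => w; rewrite -EFinB -mulrBr.
have : (\int[P]_w ((f w * V w)%:E - (f w * Z w)%:E) = 0)%E.
  rewrite -[RHS](integral_mul_eq0 iU U0 mf ifU).
  by apply: eq_integral => w _; rewrite -EFinB -mulrBr.
rewrite integralB_EFin// => /eqP.
rewrite sube_eq//; last exact: integrable_fin_num ifV.
by rewrite add0e => /eqP <-.
Unshelve. all: by end_near. Qed.

End pull_out.

(** * Moment bounds *)

Section elementary_inequalities.
Context {R : realType}.

(** The product [h] below is 2 (x^3 + y^3 + z^3 - 3xyz). *)
Lemma young3 (x y z : R) : 0 <= x -> 0 <= y -> 0 <= z ->
  x * y * z <= x ^+ 3 + y ^+ 3 + z ^+ 3.
Proof.
move=> x0 y0 z0.
have h : 0 <= (x + y + z) * ((x - y) ^+ 2 + (y - z) ^+ 2 + (z - x) ^+ 2).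
  by rewrite mulr_ge0 ?addr_ge0 ?sqr_ge0.
have h2 : 0 <= x * y * z by rewrite !mulr_ge0.
nra.
Qed.

(** If a <= b^(p-1) then a b <= b^p; otherwise b <= a^(1/(p-1)) and a b is at most a to the
    conjugate exponent, which a >= 1 allows to be rounded up to [m]. *)
Lemma young_powR (a b p : R) (m : nat) : 1 < p -> p / (p - 1) <= m%:R ->
  1 <= a -> 0 <= b -> a * b <= a ^+ m + b `^ p.
Proof.
move=> p1 pm a1 b0; have p10 : 0 < p - 1 by rewrite subr_gt0.
have a0 : 0 < a by rewrite (lt_le_trans ltr01).
have [ab|ab] := leP a (b `^ (p - 1)).
  have -> : b `^ p = b `^ (p - 1) * b.
    move: b0; rewrite le_eqVlt => /predU1P[<-|b0].
      by rewrite mulr0 powR0// gt_eqF// (lt_trans ltr01).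
    by rewrite -[X in _ = _ * X](powRr1 (ltW b0)) -powRD ?subrK// (gt_eqF b0) implybT.
  rewrite ler_wpDl ?exprn_ge0 ?(ltW a0)//.
  by rewrite ler_wpM2r.
rewrite ler_wpDr ?powR_ge0//.
have ba : b <= a `^ (p - 1)^-1.
  have q0 : 0 <= (p - 1)^-1 by rewrite invr_ge0 ltW.
  have := @ge0_ler_powR R _ q0 (b `^ (p - 1)) a.
  rewrite !nnegrE powR_ge0 (ltW a0) (ltW ab) => /(_ isT isT isT).
  by rewrite -powRrM mulfV ?gt_eqF// powRr1.
apply: (@le_trans _ _ (a * a `^ (p - 1)^-1)); first by rewrite ler_wpM2l// ltW.
rewrite -[X in X * _ <= _](powRr1 (ltW a0)) -powRD ?(gt_eqF a0) ?implybT//.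
rewrite -powR_mulrn ?(ltW a0)// ler_powR//.
apply: le_trans pm; rewrite le_eqVlt; apply/orP; left; apply/eqP; field.
by rewrite gt_eqF.
Qed.

Lemma exprD_bound (x y : R) m : 0 <= x -> 0 <= y ->
  (x + y) ^+ m <= 2 ^+ m * (x ^+ m + y ^+ m).
Proof.
move=> x0 y0; have [xy|/ltW xy] := leP x y.
  apply: (@le_trans _ _ ((2 * y) ^+ m)).
    by rewrite lerXn2r ?nnegrE ?addr_ge0 ?mulr_ge0//; lra.
  by rewrite exprMn ler_wpM2l ?exprn_ge0// lerDr exprn_ge0.
apply: (@le_trans _ _ ((2 * x) ^+ m)).
  by rewrite lerXn2r ?nnegrE ?addr_ge0 ?mulr_ge0//; lra.
by rewrite exprMn ler_wpM2l ?exprn_ge0// lerDl exprn_ge0.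
Qed.

Lemma norm1_expr_bound d (y : 'rV[R]_d) m : (0 < d)%N ->
  norm1 y ^+ m <= d%:R ^+ m * \sum_i `|y 0 i| ^+ m.
Proof.
move=> d0; pose i0 := Ordinal d0.
pose j := [arg max_(i > i0) `|y 0 i|]%O.
have jmax i : `|y 0 i| <= `|y 0 j|.
  by rewrite /j; case: arg_maxP => // k _; apply.
apply: (@le_trans _ _ ((d%:R * `|y 0 j|) ^+ m)).
  rewrite lerXn2r ?nnegrE ?norm1_ge0 ?mulr_ge0//.
  rewrite /norm1 mulr_natl -[X in _ *+ X](card_ord d) -sumr_const.
  exact: ler_sum.
rewrite exprMn ler_wpM2l ?exprn_ge0// (bigD1 j)//= lerDl.
by apply: sumr_ge0 => i _; exact: exprn_ge0.
Qed.

End elementary_inequalities.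

Section moments.
Context {R : realType} {dO : measure_display} {O : measurableType dO}.
Variable P : probability O R.
Implicit Types Y Z : O -> R.

Let E Y := \int[P]_w Y w.

Definition integ Y := P.-integrable setT (EFin \o Y).

(** Integrability is part of the bound, since the real-valued integral of a non-integrable function
    says nothing. *)
Definition Ebd Y (c : R) := integ Y /\ E (fun w => `|Y w|) <= c.

Definition Eeq Y Z := [/\ integ Y, integ Z & E Y = E Z].

Lemma integ_measurable Y : integ Y -> measurable_fun setT Y.
Proof. by case/integrableP => /measurable_EFinP. Qed.

Lemma integ_norm Y : integ Y -> integ (fun w => `|Y w|).
Proof. exact: integrable_norm. Qed.

Lemma integD Y Z : integ Y -> integ Z -> integ (fun w => Y w + Z w).
Proof.
move=> iY iZ; rewrite /integ (_ : _ \o _ = (EFin \o Y) \+ (EFin \o Z))%E//.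
exact: integrableD.
Qed.

Lemma integZ c Y : integ Y -> integ (fun w => c * Y w).
Proof.
move=> iY; rewrite /integ (_ : _ \o _ = (fun w => c%:E * (EFin \o Y) w))%E//.
exact: integrableZl.
Qed.

Lemma integ_cst c : integ (fun=> c).
Proof. exact: finite_measure_integrable_cst. Qed.

Lemma integ_sum (I : finType) (F : I -> O -> R) :
  (forall i, integ (F i)) -> integ (fun w => \sum_i F i w).
Proof.
move=> iF; rewrite /integ (_ : _ \o _ = (fun w => \sum_i (EFin \o F i) w)%E).
  by apply: integrable_sum => // i _; exact: iF.
by apply/funext => w /=; rewrite sumEFin.
Qed.

Lemma integ_dom Y Z : measurable_fun setT Y -> integ Z ->
  (forall w, `|Y w| <= Z w) -> integ Y.
Proof.
move=> mY iZ YZ; apply: le_integrable iZ => //; first exact/measurable_EFinP.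
by move=> w _ /=; rewrite lee_fin (le_trans (YZ w))// ler_norm.
Qed.

Lemma ED Y Z : integ Y -> integ Z -> E (fun w => Y w + Z w) = E Y + E Z.
Proof. exact: RintegralD. Qed.

Lemma EZ c Y : integ Y -> E (fun w => c * Y w) = c * E Y.
Proof. exact: RintegralZl. Qed.

Lemma E_sum (I : finType) (F : I -> O -> R) :
  (forall i, integ (F i)) -> E (fun w => \sum_i F i w) = \sum_i E (F i).
Proof.
move=> iF; rewrite /E /Rintegral.
under eq_integral do rewrite -sumEFin.
rewrite integral_sum// -sum_fine// => i _.
exact: integrable_fin_num (iF i).
Qed.

Lemma E_cst c : E (fun=> c) = c.
Proof.
rewrite /E Rintegral_cst//=.
by rewrite probability_setT mulr1.
Qed.

Lemma E_le Y Z : integ Y -> integ Z -> (forall w, Y w <= Z w) -> E Y <= E Z.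
Proof. by move=> iY iZ YZ; apply: le_Rintegral. Qed.

Lemma Eeq_refl Y : integ Y -> Eeq Y Y.
Proof. by []. Qed.

Lemma EeqD Y1 Z1 Y2 Z2 : Eeq Y1 Z1 -> Eeq Y2 Z2 ->
  Eeq (fun w => Y1 w + Y2 w) (fun w => Z1 w + Z2 w).
Proof.
move=> [? ? e1] [? ? e2]; split; [exact: integD|exact: integD|].
by rewrite !ED// e1 e2.
Qed.

Lemma EeqZ c Y Z : Eeq Y Z -> Eeq (fun w => c * Y w) (fun w => c * Z w).
Proof.
by move=> [? ? e]; split; [exact: integZ|exact: integZ|rewrite !EZ// e].
Qed.

Lemma Eeq_sum (I : finType) (F G : I -> O -> R) :
  (forall i, Eeq (F i) (G i)) ->
  Eeq (fun w => \sum_i F i w) (fun w => \sum_i G i w).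
Proof.
move=> FG; have iF i : integ (F i) by case: (FG i).
have iG i : integ (G i) by case: (FG i).
split; [exact: integ_sum|exact: integ_sum|rewrite !E_sum//].
by apply: eq_bigr => i _; case: (FG i).
Qed.

Lemma Ebd_le Y c : Ebd Y c -> `|E Y| <= c.
Proof.
by move=> [iY]; apply: le_trans; apply: le_normr_Rintegral.
Qed.

Lemma Ebd_ge0 Y c : Ebd Y c -> 0 <= c.
Proof. by move=> [_]; apply: le_trans; apply: Rintegral_ge0. Qed.

Lemma Ebd_dom Y Z c : measurable_fun setT Y -> (forall w, `|Y w| <= Z w) ->
  Ebd Z c -> Ebd Y c.
Proof.
move=> mY YZ [iZ h]; have iY := integ_dom mY iZ YZ; split => //.
apply: le_trans h; apply: E_le; [exact: integ_norm|exact: integ_norm|].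
by move=> w; rewrite (le_trans (YZ w))// ler_norm.
Qed.

Lemma EbdD Y Z c c' : Ebd Y c -> Ebd Z c' -> Ebd (fun w => Y w + Z w) (c + c').
Proof.
move=> [iY hY] [iZ hZ]; split; first exact: integD.
apply: (@le_trans _ _ (E (fun w => `|Y w| + `|Z w|))).
  apply: E_le => [||w]; [exact/integ_norm/integD| |exact: ler_normD].
  by apply: integD; exact: integ_norm.
by rewrite ED ?lerD//; exact: integ_norm.
Qed.

Lemma EbdZ a Y c : Ebd Y c -> Ebd (fun w => a * Y w) (`|a| * c).
Proof.
move=> [iY hY]; split; first exact: integZ.
rewrite (_ : (fun w => `|a * Y w|) = (fun w => `|a| * `|Y w|)).
  by rewrite EZ ?ler_wpM2l//; exact: integ_norm.
by apply/funext => w; rewrite normrM.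
Qed.

Lemma Ebd_sum (I : finType) (F : I -> O -> R) c :
  (forall i, Ebd (F i) c) -> Ebd (fun w => \sum_i F i w) (#|I|%:R * c).
Proof.
move=> FB; have iF i : integ (F i) by case: (FB i).
split; first exact: integ_sum.
apply: (@le_trans _ _ (E (fun w => \sum_i `|F i w|))).
  apply: E_le => [||w]; [exact/integ_norm/integ_sum| |exact: ler_norm_sum].
  by apply: integ_sum => i; exact: integ_norm.
rewrite E_sum; last by move=> i; exact: integ_norm.
rewrite mulr_natl -sumr_const; apply: ler_sum => i _.
by case: (FB i).
Qed.

Lemma Ebd_cst c : Ebd (fun=> c) `|c|.
Proof. by split; [exact: integ_cst|rewrite E_cst]. Qed.

(** The integral of a nonnegative function is a supremum over simple functions below it. This serves
    for the operator norm, a supremum for which only measurability of the matrix entries is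
    given. *)
Lemma ge0_le_integral_nonmeas (f g : O -> \bar R) :
  (forall w, 0 <= f w)%E -> (forall w, f w <= g w)%E ->
  (\int[P]_w f w <= \int[P]_w g w)%E.
Proof.
move=> f0 fg; have g0 w : (0 <= g w)%E by exact: le_trans (fg w).
rewrite !ge0_integralTE//; apply: ereal_sup_le => _ [h /= hf <-].
by exists h => // w; exact: le_trans (fg w).
Qed.

Lemma Lnorm_Ebd (p c : R) (f g : O -> R) : 0 < p ->
  measurable_fun setT f -> (forall w, `|f w| <= `|g w|) ->
  ('N[P]_(p%:E)[(fun w => (g w)%:E)] <= c%:E)%E ->
  Ebd (fun w => `|f w| `^ p) (c `^ p).
Proof.
move=> p0 mf fg gc.
have N0 := Lnorm_ge0 P p%:E (fun w => (g w)%:E).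
have c0 : 0 <= c by rewrite -lee_fin (le_trans N0).
have h : (\int[P]_w (`|f w| `^ p)%:E <= (c `^ p)%:E)%E.
  apply: (@le_trans _ _ (\int[P]_w (`|(g w)%:E| `^ p)%E)%E).
    apply: ge0_le_integral_nonmeas => w; first by rewrite lee_fin powR_ge0.
    by rewrite /= lee_fin ge0_ler_powR ?nnegrE ?(ltW p0).
  rewrite -(poweR_Lnorm P (fun w => (g w)%:E)) ?gt_eqF// -poweR_EFin.
  by apply: gt0_ler_poweR => //; rewrite ?(ltW p0)// in_itv/= ?leey ?andbT ?lee_fin.
have iF : integ (fun w => `|f w| `^ p).
  apply/integrableP; split.
    apply/measurable_EFinP.
    apply: (measurableT_comp (measurable_powR p)).
    exact: measurableT_comp.
  under eq_integral do rewrite /= ger0_norm ?powR_ge0//.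
  exact: le_lt_trans h (ltry _).
split => //; rewrite -lee_fin; apply: le_trans h; rewrite /E /Rintegral.
under eq_integral do rewrite ger0_norm ?powR_ge0//.
by rewrite fineK//; exact: integrable_fin_num iF.
Qed.

Lemma Ebd_expr (m : nat) (c : R) (f : O -> R) :
  Ebd (fun w => `|f w| `^ m%:R) c -> Ebd (fun w => `|f w| ^+ m) c.
Proof.
by under eq_fun do rewrite powR_mulrn//.
Qed.

End moments.

(** * One step of the chain *)

Lemma monom_madd1 {R : realType} {d} (y : 'rV[R]_d) (l : multi d) i :
  monom y (madd1 l i) = monom y l * y 0 i.
Proof.
rewrite /monom; under eq_bigr do rewrite ffunE exprD.
rewrite big_split /=; congr (_ * _); rewrite (bigD1 i)//= eqxx expr1.
by rewrite big1 ?mulr1// => j /negbTE ->.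
Qed.

Lemma monom_m0 {R : realType} {d} (y : 'rV[R]_d) : monom y m0 = 1.
Proof. by rewrite /monom big1// => i _; rewrite ffunE expr0. Qed.

Section vector_moments.
Context {R : realType} {d : nat} {dO : measure_display} {O : measurableType dO}.
Variable P : probability O R.
Hypothesis d0 : (0 < d)%N.
Variable X : O -> 'rV[R]_d.
Hypothesis mX : random_vector X.

Lemma measurable_norm1 : measurable_fun setT (fun w => norm1 (X w)).
Proof. by apply: measurable_sum => i; exact: measurableT_comp. Qed.

Lemma measurable_weight : measurable_fun setT (fun w => weight (X w)).
Proof. exact: measurable_funD measurable_norm1. Qed.

Lemma norm1_moment m c : (forall i, Ebd P (fun w => `|X w 0 i| ^+ m) c) ->
  Ebd P (fun w => norm1 (X w) ^+ m) (d%:R ^+ m * (d%:R * c)).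
Proof.
move=> Xc; apply: (Ebd_dom (Z := fun w => d%:R ^+ m * \sum_i `|X w 0 i| ^+ m)).
- exact/measurable_funX/measurable_norm1.
- move=> w; rewrite ger0_norm ?exprn_ge0 ?norm1_ge0//.
  exact: norm1_expr_bound.
have := EbdZ (d%:R ^+ m) (Ebd_sum Xc).
by rewrite card_ord ger0_norm// exprn_ge0.
Qed.

Lemma weight_moment m c : (forall i, Ebd P (fun w => `|X w 0 i| ^+ m) c) ->
  Ebd P (fun w => weight (X w) ^+ m)
    (2 ^+ m * (1 + d%:R ^+ m * (d%:R * c))).
Proof.
move=> Xc; apply: (Ebd_dom (Z := fun w => 2 ^+ m * (1 + norm1 (X w) ^+ m))).
- exact/measurable_funX/measurable_weight.
- move=> w; rewrite ger0_norm ?exprn_ge0 ?weight_ge0//.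
  by rewrite (le_trans (exprD_bound m ler01 (norm1_ge0 _)))// expr1n.
have := EbdZ (2 ^+ m) (EbdD (Ebd_cst P 1) (norm1_moment Xc)).
by rewrite normr1 ger0_norm// exprn_ge0.
Qed.

End vector_moments.

(** At time t_n, [V0], [V] and [W] stand for d_t u, the space derivatives of u and those of d_t u;
    [U] and [U'] are u(t_n, X_n) and u(t_(n+1), X_(n+1)). *)
Section one_step.
Context {R : realType} {d : nat} {dO : measure_display} {O : measurableType dO}.
Variable P : probability O R.
Variables (X X' : O -> 'rV[R]_d) (D : set 'rV[R]_d).
Let dX w := X' w - X w.
Hypotheses (mX : random_vector X) (mX' : random_vector X').
Hypothesis DX : forall w, D (X w).
Variable GG : set (set O).
Hypothesis GGm : GG `<=` measurable.
Hypothesis GX : forall i, meas_wrt <<s GG>> (fun w => X w 0 i).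
Variables (V0 : 'rV[R]_d -> R) (V W : multi d -> 'rV[R]_d -> R).
Variables (B : R) (K : nat).
Hypothesis B0 : 0 <= B.
Hypothesis cV0 : {within D, continuous V0}.
Hypothesis cV : forall m, (mlen m <= 3)%N -> {within D, continuous (V m)}.
Hypothesis cW : forall m, (mlen m <= 1)%N -> {within D, continuous (W m)}.
Hypothesis V0B : forall y, D y -> `|V0 y| <= B * weight y ^+ K.
Hypothesis VB : forall m y, (mlen m <= 3)%N -> D y ->
  `|V m y| <= B * weight y ^+ K.
Hypothesis WB : forall m y, (mlen m <= 1)%N -> D y ->
  `|W m y| <= B * weight y ^+ K.
Variables (b f : 'rV[R]_d -> 'rV[R]_d) (a g : 'rV[R]_d -> 'M[R]_d).
Variable j : multi d -> 'rV[R]_d -> R.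
Hypothesis bB : forall y i, D y -> `|b y 0 i| <= B * weight y ^+ K.
Variables (T h p c M N : R) (m q : nat).
Hypotheses (h0 : 0 < h) (hT : h <= T) (p1 : 1 < p) (c0 : 0 <= c).
Hypothesis pm : p / (p - 1) <= m%:R.
(** Weights are raised to 3K by [young3] in the remainder, to K m by [young_powR], and to 2 (K + 4)
    when integrability of products is checked. *)
Hypotheses (q1 : (3 * K <= q)%N) (q2 : (K * m <= q)%N) (q3 : (2 * (K + 4) <= q)%N).
Hypothesis wX : Ebd P (fun w => weight (X w) ^+ q) M.
Hypothesis wX' : Ebd P (fun w => weight (X' w) ^+ q) M.
Hypothesis ndX : Ebd P (fun w => norm1 (dX w) ^+ 12) (N * h ^+ 6).
Hypothesis fB : forall i,
  measurable_fun setT (fun w => f (X w) 0 i) /\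
  Ebd P (fun w => `|f (X w) 0 i| `^ p) ((c * h ^+ 2) `^ p).
Hypothesis gB : forall i k,
  measurable_fun setT (fun w => g (X w) i k) /\
  Ebd P (fun w => `|g (X w) i k| `^ p) ((c * h ^+ 2) `^ p).
Hypothesis jB : forall l, mlen l = 3%N ->
  measurable_fun setT (fun w => j l (X w)) /\
  Ebd P (fun w => `|j l (X w)| `^ p) ((c * h ^+ 2) `^ p).
Hypothesis ce1 : forall i, is_cexp P <<s GG>> (fun w => dX w 0 i)
  (fun w => b (X w) 0 i * h + f (X w) 0 i).
Hypothesis ce2 : forall i k, is_cexp P <<s GG>>
  (fun w => ((dX w)^T *m dX w) i k)
  (fun w => a (X w) i k * h + g (X w) i k).
Hypothesis ce3 : forall l, mlen l = 3%N ->
  is_cexp P <<s GG>> (fun w => monom (dX w) l) (fun w => j l (X w)).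
Hypothesis pde : forall y, D y ->
  V0 y + 2^-1 * (\sum_i \sum_k a y i k * V (madd1 (madd1 m0 i) k) y)
  + \sum_i b y 0 i * V (madd1 m0 i) y = 0.
Variables U U' : O -> R.
Hypotheses (mU : measurable_fun setT U) (mU' : measurable_fun setT U').
Hypothesis UB : forall w, `|U w| <= B * weight (X w) ^+ K.
Hypothesis UB' : forall w, `|U' w| <= B * weight (X' w) ^+ K.
Hypothesis expansion : forall w,
  `|U' w - U w - (h * V0 (X w) + dirD V 1 m0 (dX w) (X w)
     + dirD V 2 m0 (dX w) (X w) / 2 + dirD V 3 m0 (dX w) (X w) / 6
     + h * dirD W 1 m0 (dX w) (X w))|
  <= B * (weight (X w) * weight (X' w)) ^+ K *
     (h ^+ 2 + h * norm1 (dX w) ^+ 2 + norm1 (dX w) ^+ 4).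

Let e1 i : multi d := madd1 m0 i.
Let e2 i k : multi d := madd1 (e1 i) k.
Let e3 i k l : multi d := madd1 (e2 i k) l.

Let e1E i : mlen (e1 i) = 1%N. Proof. by rewrite mlen_madd1 mlen_m0. Qed.
Let e2E i k : mlen (e2 i k) = 2%N. Proof. by rewrite mlen_madd1 e1E. Qed.
Let e3E i k l : mlen (e3 i k l) = 3%N. Proof. by rewrite mlen_madd1 e2E. Qed.

(** The directional derivatives are written out as functions of X times monomials of the increment,
    the form to which conditional moments apply. *)
Let main w := h * V0 (X w) + \sum_i V (e1 i) (X w) * dX w 0 i
  + 2^-1 * (\sum_i \sum_k V (e2 i k) (X w) * ((dX w)^T *m dX w) i k)
  + 6^-1 * (\sum_i \sum_k \sum_l V (e3 i k l) (X w) * monom (dX w) (e3 i k l))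
  + h * (\sum_i W (e1 i) (X w) * dX w 0 i).

Let gramE w i k : ((dX w)^T *m dX w) i k = dX w 0 i * dX w 0 k.
Proof. by rewrite mxE big_ord1 mxE. Qed.

Let main_dirD w : main w = h * V0 (X w) + dirD V 1 m0 (dX w) (X w)
     + dirD V 2 m0 (dX w) (X w) / 2 + dirD V 3 m0 (dX w) (X w) / 6
     + h * dirD W 1 m0 (dX w) (X w).
Proof.
rewrite /main; congr (_ + _ + _ + _ + _ * _).
- by apply: eq_bigr => i _; rewrite mulrC.
- rewrite mulrC; congr (_ * _); apply: eq_bigr => i _; rewrite mulr_sumr.
  by apply: eq_bigr => k _; rewrite gramE /= mulrC mulrA.
- rewrite mulrC; congr (_ * _); apply: eq_bigr => i _; rewrite mulr_sumr.
  apply: eq_bigr => k _; rewrite -/dirD !mulr_sumr; apply: eq_bigr => l _.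
  by rewrite !monom_madd1 monom_m0 mul1r /= mulrC !mulrA.
- by apply: eq_bigr => i _; rewrite mulrC.
Qed.

Let mcomp (phi : 'rV[R]_d -> R) : {within D, continuous phi} ->
  measurable_fun setT (fun w => phi (X w)).
Proof. by move=> cphi; apply: measurable_comp_within cphi DX. Qed.

Let Gcomp (phi : 'rV[R]_d -> R) : {within D, continuous phi} ->
  meas_wrt <<s GG>> (fun w => phi (X w)).
Proof.
move=> cphi; apply/meas_wrtP.
apply: (@measurable_comp_within _ _ _ (g_sigma_algebraType GG)) cphi DX.
by move=> i; apply/meas_wrtP.
Qed.

Let mdX i : measurable_fun setT (fun w => dX w 0 i).
Proof.
rewrite (_ : (fun _ => _) = (fun w => X' w 0 i - X w 0 i)).
  exact: measurable_funB.
by apply/funext => w; rewrite !mxE.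
Qed.

Let ww w := weight (X w) * weight (X' w).

Let ww1 w : 1 <= ww w.
Proof. by rewrite /ww -[1]mulr1 ler_pM// weight_ge1. Qed.

Let norm1_dX w : norm1 (dX w) <= ww w.
Proof.
apply: (@le_trans _ _ (norm1 (X w) + norm1 (X' w))).
  rewrite /norm1 -big_split /=; apply: ler_sum => i _.
  by rewrite !mxE (le_trans (ler_normB _ _))// addrC.
have := norm1_ge0 (X w); have := norm1_ge0 (X' w); rewrite /ww /weight; nra.
Qed.

(** A product of two powers is at most the sum of their squares, which separates X from X'. *)
Let ww_integ k : (2 * k <= q)%N -> integ P (fun w => ww w ^+ k).
Proof.
move=> kq.
apply: (integ_dom (Z := fun w => weight (X w) ^+ q + weight (X' w) ^+ q)).
- apply/measurable_funX/measurable_funM; exact: measurable_weight.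
- by apply: integD; [case: wX|case: wX'].
move=> w; rewrite ger0_norm ?exprn_ge0 ?(le_trans ler01 (ww1 w))//.
apply: (@le_trans _ _ (weight (X w) ^+ (2 * k) + weight (X' w) ^+ (2 * k))).
  rewrite /ww exprMn mulnC !exprM.
  have x0 : 0 <= weight (X w) ^+ k by rewrite exprn_ge0 ?weight_ge0.
  have y0 : 0 <= weight (X' w) ^+ k by rewrite exprn_ge0 ?weight_ge0.
  nra.
by rewrite lerD// ler_weXn2l ?weight_ge1.
Qed.

Let integ_pol k l (Y : O -> R) : (k <= K)%N -> (l <= 4)%N -> measurable_fun setT Y ->
  (forall w, `|Y w| <= B * ww w ^+ k * norm1 (dX w) ^+ l) -> integ P Y.
Proof.
move=> kK l4 mY YB.
apply: (integ_dom (Z := fun w => B * ww w ^+ (K + 4)%N)) => //.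
  exact/integZ/ww_integ.
move=> w; apply: le_trans (YB w) _; rewrite -mulrA ler_wpM2l// exprD.
apply: ler_pM; rewrite ?exprn_ge0 ?norm1_ge0 ?(le_trans ler01 (ww1 w))//.
  by rewrite ler_weXn2l.
apply: (@le_trans _ _ (ww w ^+ l)); last by rewrite ler_weXn2l.
by rewrite lerXn2r ?nnegrE ?norm1_ge0// (le_trans ler01 (ww1 w)).
Qed.

Let weight_le_ww w k : weight (X w) ^+ k <= ww w ^+ k.
Proof.
by rewrite lerXn2r ?nnegrE ?weight_ge0 ?(le_trans ler01 (ww1 w))// ler_peMr
  ?weight_ge0 ?weight_ge1.
Qed.

Let pull (phi : 'rV[R]_d -> R) (Y Z : O -> R) l : (l <= 4)%N ->
  {within D, continuous phi} -> (forall y, D y -> `|phi y| <= B * weight y ^+ K) ->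
  measurable_fun setT Y -> (forall w, `|Y w| <= norm1 (dX w) ^+ l) ->
  is_cexp P <<s GG>> Y Z ->
  Eeq P (fun w => phi (X w) * Y w) (fun w => phi (X w) * Z w).
Proof.
move=> l4 cphi phiB mY YB ceY.
have iY : integ P (fun w => phi (X w) * Y w).
  apply: (integ_pol (leqnn K) l4).
    by apply: measurable_funM => //; exact: mcomp.
  move=> w; rewrite normrM ler_pM//.
  by rewrite (le_trans (phiB _ (DX w)))// ler_wpM2l// weight_le_ww.
have [iZ e] := is_cexp_pull GGm ceY (Gcomp cphi) iY.
by split => //; rewrite /Rintegral e.
Qed.

Let main' w := h * V0 (X w)
  + \sum_i V (e1 i) (X w) * (b (X w) 0 i * h + f (X w) 0 i)
  + 2^-1 * (\sum_i \sum_k V (e2 i k) (X w) * (a (X w) i k * h + g (X w) i k))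
  + 6^-1 * (\sum_i \sum_k \sum_l V (e3 i k l) (X w) * j (e3 i k l) (X w))
  + h * (\sum_i W (e1 i) (X w) * (b (X w) 0 i * h + f (X w) 0 i)).

Let V0_integ : integ P (fun w => V0 (X w)).
Proof.
apply: (integ_pol (leqnn K) (leq0n 4)); first exact: mcomp.
move=> w; rewrite expr0 mulr1 (le_trans (V0B (DX w)))//.
by rewrite ler_wpM2l// weight_le_ww.
Qed.

Let main_Eeq : Eeq P main main'.
Proof.
apply: EeqD; first apply: EeqD; first apply: EeqD; first apply: EeqD.
- by apply: EeqZ; exact: Eeq_refl V0_integ.
- apply: Eeq_sum => i; apply: (@pull _ _ _ 1) => //.
  + by apply: cV; rewrite e1E.
  + by move=> y; apply: VB; rewrite e1E.
  + by move=> w; rewrite expr1 normr_coord_norm1.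
- apply: EeqZ; apply: Eeq_sum => i; apply: Eeq_sum => k.
  apply: (@pull _ _ _ 2) => //.
  + by apply: cV; rewrite e2E.
  + by move=> y; apply: VB; rewrite e2E.
  + by under eq_fun do rewrite gramE; exact: measurable_funM.
  + move=> w; rewrite gramE normrM expr2 ler_pM// normr_coord_norm1//.
- apply: EeqZ; apply: Eeq_sum => i; apply: Eeq_sum => k; apply: Eeq_sum => l.
  apply: (@pull _ _ _ 3) => //.
  + by apply: cV; rewrite e3E.
  + by move=> y; apply: VB; rewrite e3E.
  + under eq_fun do rewrite !monom_madd1 monom_m0 mul1r.
    by do 2 (apply: measurable_funM => //).
  + move=> w; rewrite !monom_madd1 monom_m0 mul1r !normrM exprSr expr2.
    by rewrite !ler_pM ?mulr_ge0 ?normr_coord_norm1.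
  + exact: ce3.
- apply: EeqZ; apply: Eeq_sum => i; apply: (@pull _ _ _ 1) => //.
  + by apply: cW; rewrite e1E.
  + by move=> y; apply: WB; rewrite e1E.
  + by move=> w; rewrite expr1 normr_coord_norm1.
Qed.

(** What is left of [main'] once h times the PDE is subtracted; the diffusion matrix has
    disappeared. *)
Let res w := \sum_i V (e1 i) (X w) * f (X w) 0 i
  + 2^-1 * (\sum_i \sum_k V (e2 i k) (X w) * g (X w) i k)
  + 6^-1 * (\sum_i \sum_k \sum_l V (e3 i k l) (X w) * j (e3 i k l) (X w))
  + h * (\sum_i (h * (W (e1 i) (X w) * b (X w) 0 i) + W (e1 i) (X w) * f (X w) 0 i)).

Let main'_res w : main' w = res w.
Proof.
rewrite /main' /res.
have pdeX : V0 (X w) + 2^-1 * (\sum_i \sum_k a (X w) i k * V (e2 i k) (X w))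
  + \sum_i b (X w) 0 i * V (e1 i) (X w) = 0 := pde (DX w).
have -> : \sum_i V (e1 i) (X w) * (b (X w) 0 i * h + f (X w) 0 i)
  = h * (\sum_i b (X w) 0 i * V (e1 i) (X w)) + \sum_i V (e1 i) (X w) * f (X w) 0 i.
  by rewrite mulr_sumr -big_split /=; apply: eq_bigr => i _; ring.
have -> : \sum_i \sum_k V (e2 i k) (X w) * (a (X w) i k * h + g (X w) i k)
  = h * (\sum_i \sum_k a (X w) i k * V (e2 i k) (X w))
    + \sum_i \sum_k V (e2 i k) (X w) * g (X w) i k.
  rewrite mulr_sumr -big_split /=; apply: eq_bigr => i _.
  by rewrite mulr_sumr -big_split /=; apply: eq_bigr => k _; ring.
have -> : \sum_i W (e1 i) (X w) * (b (X w) 0 i * h + f (X w) 0 i) =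
   \sum_i (h * (W (e1 i) (X w) * b (X w) 0 i) + W (e1 i) (X w) * f (X w) 0 i).
  by apply: eq_bigr => i _; ring.
set Sa := \sum_i \sum_k a (X w) i k * _ in pdeX *.
set Sb := \sum_i b (X w) 0 i * _ in pdeX *.
have -> : V0 (X w) = - (2^-1 * Sa + Sb).
  by apply/eqP; rewrite -addr_eq0 addrA pdeX.
ring.
Qed.

Let A := M + c `^ p.

Let weight_moment_le k : (k <= q)%N -> Ebd P (fun w => weight (X w) ^+ k) M.
Proof.
move=> kq; apply: Ebd_dom wX.
  exact/measurable_funX/measurable_weight.
by move=> w; rewrite ger0_norm ?exprn_ge0 ?weight_ge0// ler_weXn2l ?weight_ge1.
Qed.

(** Young's inequality is applied to weight^K and |Y| / h^2, so that h^2 factors out linearly and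
    the second term contributes c^p, whatever h. *)
Let rho_Ebd (phi : 'rV[R]_d -> R) (Y : O -> R) :
  {within D, continuous phi} -> (forall y, D y -> `|phi y| <= B * weight y ^+ K) ->
  measurable_fun setT Y -> Ebd P (fun w => `|Y w| `^ p) ((c * h ^+ 2) `^ p) ->
  Ebd P (fun w => phi (X w) * Y w) (B * h ^+ 2 * A).
Proof.
move=> cphi phiB mY YB.
have h20 : 0 < h ^+ 2 by rewrite exprn_gt0.
have hp0 : (h ^+ 2) `^ p != 0 by rewrite gt_eqF// powR_gt0.
apply: (Ebd_dom (Z := fun w => B * h ^+ 2 * (weight (X w) ^+ (K * m)
    + ((h ^+ 2) `^ p)^-1 * `|Y w| `^ p))).
- by apply: measurable_funM => //; exact: mcomp.
- move=> w; rewrite normrM.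
  apply: (@le_trans _ _ (B * weight (X w) ^+ K * `|Y w|)).
    by rewrite ler_wpM2r// phiB.
  rewrite -mulrA -[leRHS]mulrA ler_wpM2l//.
  have wK1 : 1 <= weight (X w) ^+ K by rewrite exprn_ege1// weight_ge1.
  have Y0 : 0 <= `|Y w| / h ^+ 2 by rewrite divr_ge0// ltW.
  have hV : ((h ^+ 2)^-1) `^ p = ((h ^+ 2) `^ p)^-1.
    apply: (mulIf hp0); rewrite mulVf// -powRM ?invr_ge0 ?(ltW h20)//.
    by rewrite mulVf ?powR1// gt_eqF.
  have := young_powR p1 pm wK1 Y0.
  rewrite -exprM powRM ?invr_ge0 ?(ltW h20)// hV [_ `^ _ * _^-1]mulrC.
  move=> /(ler_wpM2l (ltW h20)); apply: le_trans.
  by rewrite mulrCA [_ ^+ 2 * _]mulrCA mulfV ?gt_eqF// mulr1.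
have := EbdZ (B * h ^+ 2) (EbdD (weight_moment_le q2) (EbdZ ((h ^+ 2) `^ p)^-1 YB)).
rewrite !ger0_norm ?invr_ge0 ?powR_ge0 ?mulr_ge0 ?(ltW h0)//.
rewrite [_^-1 * _](_ : _ = c `^ p)//.
by rewrite powRM ?(ltW h20)// mulrCA mulVf// mulr1.
Qed.

Let res_Ebd : Ebd P res (d%:R * (B * h ^+ 2 * A)
  + 2^-1 * (d%:R * (d%:R * (B * h ^+ 2 * A)))
  + 6^-1 * (d%:R * (d%:R * (d%:R * (B * h ^+ 2 * A))))
  + h * (d%:R * (h * (B ^+ 2 * M) + B * h ^+ 2 * A))).
Proof.
apply: EbdD; first apply: EbdD; first apply: EbdD.
- rewrite -[X in X%:R * _](card_ord d); apply: Ebd_sum => i.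
  have [mf Bf] := fB i; apply: rho_Ebd => //.
  + by apply: cV; rewrite e1E.
  + by move=> y; apply: VB; rewrite e1E.
- rewrite -[2^-1 in X in Ebd _ _ X]ger0_norm ?invr_ge0//.
  apply: EbdZ; rewrite -[X in X%:R * _](card_ord d); apply: Ebd_sum => i.
  rewrite -[X in X%:R * _](card_ord d); apply: Ebd_sum => k.
  have [mg Bg] := gB i k; apply: rho_Ebd => //.
  + by apply: cV; rewrite e2E.
  + by move=> y; apply: VB; rewrite e2E.
- rewrite -[6^-1 in X in Ebd _ _ X]ger0_norm ?invr_ge0//.
  apply: EbdZ; rewrite -[X in X%:R * _](card_ord d); apply: Ebd_sum => i.
  rewrite -[X in X%:R * _](card_ord d); apply: Ebd_sum => k.
  rewrite -[X in X%:R * _](card_ord d); apply: Ebd_sum => l.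
  have [mj Bj] := jB (e3E i k l); apply: rho_Ebd => //.
  + by apply: cV; rewrite e3E.
  + by move=> y; apply: VB; rewrite e3E.
rewrite -[X in X * (_ * (_ + _))](gtr0_norm h0).
apply: EbdZ; rewrite -[X in X%:R * _](card_ord d); apply: Ebd_sum => i.
have [mf Bf] := fB i; apply: EbdD; last first.
  apply: rho_Ebd => //.
  + by apply: cW; rewrite e1E.
  + by move=> y; apply: WB; rewrite e1E.
rewrite -[X in X * (_ * _)](gtr0_norm h0); apply: EbdZ.
rewrite -[B ^+ 2]ger0_norm ?exprn_ge0//.
apply: (Ebd_dom (Z := fun w => B ^+ 2 * weight (X w) ^+ (2 * K))).
- apply: measurable_funM; first by apply: mcomp; apply: cW; rewrite e1E.
  (* Measurability of b(X) is read off from [ce1], where b h + f is integrable, and from that of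
     f(X). *)
  rewrite (_ : (fun _ => _) = (fun w => h^-1 * ((b (X w) 0 i * h + f (X w) 0 i)
    - f (X w) 0 i))); last by apply/funext => w; field; rewrite gt_eqF.
  apply: measurable_funM => //; apply: measurable_funB => //.
  by have [_ + _ _] := ce1 i; exact: integ_measurable.
- move=> w; rewrite normrM mulnC exprM -exprMn expr2.
  by rewrite ler_pM// ?WB ?bB ?e1E.
apply: EbdZ; apply: weight_moment_le; apply: leq_trans q1.
by rewrite leq_mul2r orbT.
Qed.

(** The increment is [main] plus a remainder; the mean of [main] is that of [res], and the two
    bounds are of order h^2. *)
Lemma one_step_bound :
  `|\int[P]_w U' w - \int[P]_w U w| <=
  (B * (2 * M + 2 ^+ 12 * (1 + N)) + (d%:R + d%:R ^+ 2 + d%:R ^+ 3) * (B * A)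
   + d%:R * (B ^+ 2 * M + T * (B * A))) * h ^+ 2.
Proof.
have iU : integ P U.
  apply: (integ_pol (leqnn K) (leq0n 4)) => // w.
  by rewrite expr0 mulr1 (le_trans (UB w))// ler_wpM2l// weight_le_ww.
have iU' : integ P U'.
  apply: (integ_pol (leqnn K) (leq0n 4)) => // w.
  rewrite expr0 mulr1 (le_trans (UB' w))// ler_wpM2l//.
  by rewrite lerXn2r ?nnegrE ?weight_ge0 ?(le_trans ler01 (ww1 w))// ler_peMl
    ?weight_ge0 ?weight_ge1.
have [iM iM' EM] := main_Eeq.
have mM := integ_measurable iM.
pose rem w := U' w - U w - main w.
have remB : Ebd P rem (B * h ^+ 2 * (M + M + 2 ^+ 12 * (1 + N))).
  pose Z w := B * h ^+ 2 * (weight (X w) ^+ (3 * K) + weight (X' w) ^+ (3 * K)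
    + 2 ^+ 12 * (1 + (h ^+ 6)^-1 * norm1 (dX w) ^+ 12)).
  apply: (Ebd_dom (Z := Z)).
  - by apply: measurable_funB => //; exact: measurable_funB.
  - move=> w; rewrite /rem main_dirD; apply: le_trans (expansion w) _.
    rewrite /Z -mulrA -[leRHS]mulrA ler_wpM2l//.
    (* In the natural scale of the increment the remainder is h^2 times a polynomial in r. *)
    pose s := Num.sqrt h; pose r := norm1 (dX w) / s.
    have s0 : 0 < s by rewrite sqrtr_gt0.
    have s2 : h = s ^+ 2 by rewrite sqr_sqrtr// ltW.
    have r0 : 0 <= r by rewrite divr_ge0 ?norm1_ge0// ltW.
    have nE : norm1 (dX w) = r * s by rewrite /r divfK// gt_eqF.
    have -> : h ^+ 2 + h * norm1 (dX w) ^+ 2 + norm1 (dX w) ^+ 4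
      = h ^+ 2 * (1 + r ^+ 2 + r ^+ 4) by rewrite nE s2; ring.
    have -> : (h ^+ 6)^-1 * norm1 (dX w) ^+ 12 = r ^+ 12.
      by rewrite nE s2; field; rewrite gt_eqF.
    rewrite mulrCA ler_wpM2l ?exprn_ge0 ?(ltW h0)//.
    rewrite exprMn mulnC !exprM.
    apply: (le_trans (young3 _ _ _)); rewrite ?exprn_ge0 ?weight_ge0//.
      by rewrite !addr_ge0 ?exprn_ge0.
    (* 1 + r^2 + r^4 <= (1 + r)^4, and its cube gives the exponent 12. *)
    rewrite lerD2l; apply: (@le_trans _ _ (((1 + r) ^+ 4) ^+ 3)).
      rewrite lerXn2r ?nnegrE ?addr_ge0 ?exprn_ge0 ?addr_ge0//.
      have r3 : 0 <= r ^+ 3 by rewrite exprn_ge0.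
      by rewrite !exprS expr0 in r3 *; nra.
    rewrite -exprM (le_trans (exprD_bound _ ler01 r0))// expr1n//.
  have w3 : Ebd P (fun w => weight (X' w) ^+ (3 * K)) M.
    apply: Ebd_dom wX'; first exact/measurable_funX/measurable_weight.
    by move=> w; rewrite ger0_norm ?exprn_ge0 ?weight_ge0// ler_weXn2l ?weight_ge1.
  have h6 : 0 < h ^+ 6 by rewrite exprn_gt0.
  have := EbdZ (B * h ^+ 2) (EbdD (EbdD (weight_moment_le q1) w3)
    (EbdZ (2 ^+ 12) (EbdD (Ebd_cst P 1) (EbdZ (h ^+ 6)^-1 ndX)))).
  rewrite normr1 (ger0_norm (_ : 0 <= B * _)) ?mulr_ge0 ?exprn_ge0 ?(ltW h0)//.
  rewrite (ger0_norm (_ : 0 <= 2 ^+ 12)) ?exprn_ge0//.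
  rewrite (gtr0_norm (_ : 0 < (h ^+ 6)^-1)) ?invr_gt0// [N * _]mulrC mulKf ?gt_eqF//.
have E1 : \int[P]_w U' w - \int[P]_w U w = \int[P]_w res w + \int[P]_w rem w.
  rewrite -RintegralB// (_ : (fun w => U' w - U w) = (fun w => main w + rem w)).
    rewrite RintegralD//; last by case: remB.
    by rewrite EM; congr (_ + _); apply: eq_Rintegral => w _; exact: main'_res.
  by apply/funext => w; rewrite /rem subrKC.
rewrite E1 (le_trans (ler_normD _ _))//.
have b1 := Ebd_le res_Ebd; have b2 := Ebd_le remB.
have A0 : 0 <= A by rewrite addr_ge0 ?powR_ge0// (Ebd_ge0 wX).
have M0 := Ebd_ge0 wX.
apply: le_trans (lerD b1 b2) _.
(* The slack left by rounding 1/2 and 1/6 up to 1 and h up to T. *)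
rewrite -subr_ge0 [leRHS](_ : _ = h ^+ 2 * (B * A) *
   (d%:R ^+ 2 / 2 + d%:R ^+ 3 * 5 / 6 + d%:R * (T - h))); last by field.
have x0 : 0 <= d%:R :> R by [].
apply: mulr_ge0; first by rewrite !mulr_ge0 ?(ltW h0).
apply: addr_ge0; last by rewrite mulr_ge0// subr_ge0.
by rewrite addr_ge0// divr_ge0// ?mulr_ge0// exprn_ge0.
Qed.

End one_step.

(** * From norms of vectors and matrices to their entries *)

Section norm_bounds.
Context {R : realType} {d : nat} {dO : measure_display} {O : measurableType dO}.
Variable P : probability O R.

(** The k-th basis vector is sent to the k-th column. The supremum is an upper bound only once the
    set is known to be bounded, hence [ub]. *)
Lemma normr_entry_opnorm (A : 'M[R]_d) i k : `|A i k| <= opnorm A.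
Proof.
have ub : has_ubound [set enorm (y *m A^T) | y in [set y : 'rV_d | enorm y <= 1]].
  exists (\sum_r \sum_s `|A r s|) => _ [y /= y1 <-].
  apply: (le_trans (enorm_le_norm1 _)); apply: ler_sum => r _.
  rewrite mxE (le_trans (ler_norm_sum _ _ _))//; apply: ler_sum => s _.
  rewrite mxE normrM ler_piMl// (le_trans (normr_coord_enorm y s))//.
have mem : [set enorm (y *m A^T) | y in [set y : 'rV_d | enorm y <= 1]]
    (enorm (delta_mx 0 k *m A^T)).
  exists (delta_mx 0 k) => //=.
  rewrite /enorm (bigD1 k)//= mxE !eqxx expr1n big1 ?addr0 ?sqrtr1// => s sk.
  by rewrite mxE (negbTE sk) andbF expr0n.
apply: (@le_trans _ _ (enorm (delta_mx 0 k *m A^T))).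
  have := normr_coord_enorm (delta_mx 0 k *m A^T) i.
  by rewrite -rowE !mxE.
exact: ub_le_sup.
Qed.

Lemma Lp_le_vec_coord p c (X : O -> 'rV[R]_d) i : 0 < p -> Lp_le_vec P p X c ->
  Ebd P (fun w => `|X w 0 i| `^ p) (c `^ p).
Proof.
move=> p0 [mX Xc]; apply: Lnorm_Ebd Xc => //.
by move=> w; exact: le_trans (normr_coord_enorm _ _) (ler_norm _).
Qed.

Lemma Lp_le_vec_coord_nat m c (X : O -> 'rV[R]_d) i : (0 < m)%N -> 0 <= c ->
  Lp_le_vec P m%:R X c -> Ebd P (fun w => `|X w 0 i| ^+ m) (c ^+ m).
Proof.
move=> m0 c0 Xc; apply: Ebd_expr; rewrite -powR_mulrn//.
by apply: Lp_le_vec_coord => //; rewrite ltr0n.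
Qed.

End norm_bounds.

Section chain_sigma_algebra.
Context {R : realType} {d : nat} {dO : measure_display} {O : measurableType dO}.
Variable X : nat -> O -> 'rV[R]_d.

(* [sigma_gen X [set n]] is convertible to [<<s sigma_gen_base n>>]. *)
Definition sigma_gen_base (n : nat) : set (set O) :=
  [set A | exists i k (B : set R),
     [/\ [set n] i, measurable B & A = [set w | B (X i w 0 k)]] ].

Lemma sigma_gen_base_measurable n : random_vector (X n) ->
  sigma_gen_base n `<=` measurable.
Proof.
move=> mX _ [_ [k [B [/= -> mB ->]]]].
by rewrite -[X in measurable X]setTI; exact: mX.
Qed.

Lemma sigma_gen_coord n i : meas_wrt <<s sigma_gen_base n>> (fun w => X n w 0 i).
Proof. by move=> B mB; apply: sub_sigma_algebra; exists n, i, B. Qed.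

End chain_sigma_algebra.

Theorem theorem3p1 (R : realType) (d l : nat) (hd : (0 < d)%N) (hl : (0 < l)%N)
    (T : R) (hT : 0 < T)
    (D : set 'rV[R]_d)
    (hD : exists2 A : set 'rV[R]_d, convex_domain A & D = A \/ D = closure A)
    (mu : 'rV[R]_d -> 'rV[R]_d) (sigma : 'rV[R]_d -> 'M[R]_(d, l))
    (hmu : poly_growth D mu)
    (hwp : well_posed T D mu sigma)
    (* the diffusion Y, started from y0 *)
    (dY : measure_display) (OY : measurableType dY) (PY : probability OY R)
    (F : R -> set (set OY)) (W : R -> OY -> 'rV[R]_l)
    (Y : R -> OY -> 'rV[R]_d) (y0 : 'rV[R]_d) (hy0 : D y0)
    (hY : weak_solution PY D mu sigma 0 T y0 F W Y)
    (f : 'rV[R]_d -> R) (u : R -> 'rV[R]_d -> R)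
    (hu : is_value_function T D mu sigma f u)
    (hpde : classical_solution T D mu (diffusion_mx sigma) f u)
    (* the chains Y^h, one for each h = T / N *)
    (dX : nat -> measure_display) (OX : forall N, measurableType (dX N))
    (PX : forall N, probability (OX N) R)
    (X : forall N, nat -> OX N -> 'rV[R]_d)
    (hX : forall N, (0 < N)%N -> markov_chain (PX N) D y0 N (@X N))
    (hH1 : assumption_H1 T mu sigma PX X)
    (hH2 : assumption_H2 T PX X)
    (huC4 : C_pol 4 T D u) :
  exists hbar C : R, [/\ 0 < hbar, 0 < C &
    forall N, (0 < N)%N -> let h := T / N%:R in h < hbar ->
      (`| 'E_(PX N)[(fun w => f (X N N w))] - 'E_PY[(fun w => f (Y T w))] |
       <= (C * T * h)%:E)%E].
Proof.
have [A [oA _ cA] [AD DA]] : exists2 A, convex_domain A & A `<=` D /\ D `<=` closure A.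
  case: hD => A cvA [->|->]; exists A => //; split => //; exact: subset_closure.
have [cu uT _] := hpde.
have cuD t : 0 <= t <= T -> {within D, continuous (u t)}.
  by move=> tT; apply: (within_slicel cu) => y Dy.
have cut y : D y -> {within [set t | 0 <= t <= T], continuous (u ^~ y)}.
  by move=> Dy; apply: (within_slicer cu) => t tT.
have [Dv [dDv [Cu [au [Cu0 au0 Dvb]]]]] := huC4.
have [Cm [am [Cm0 am0 mub]]] := hmu.
have [hb1 [hb10 [fh [gh [jh [p [c [p1 c0 H1]]]]]]]] := hH1.
have [hb2 [hb20 H2]] := hH2.
(* One integer exponent for the growth of u and of mu; the factors 2 in [B] come from
   [pol_weight]. *)
pose K := maxn (Num.bound au) (Num.bound am).
pose B : R := 2 * Cu + 2 * Cm.
have B0 : 0 <= B by rewrite addr_ge0// mulr_ge0// ltW.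
have polB (C e : R) y : 0 < C -> C <= Cu + Cm -> 0 < e -> e <= K%:R ->
    C * (1 + enorm y `^ e) <= B * weight y ^+ K.
  move=> C0 CC e0 eK; apply: (@le_trans _ _ (C * (2 * weight y ^+ K))).
    by rewrite ler_pM2l// pol_weight.
  by rewrite mulrA ler_wpM2r ?exprn_ge0 ?weight_ge0// /B; lra.
have auK : au <= K%:R.
  rewrite (le_trans (ltW (archi_boundP (ltW au0))))// ler_nat leq_maxl//.
have amK : am <= K%:R.
  rewrite (le_trans (ltW (archi_boundP (ltW am0))))// ler_nat leq_maxr//.
have DvB k m t y : (2 * k + mlen m <= 4)%N -> 0 <= t < T -> D y ->
    `|Dv k m t y| <= B * weight y ^+ K.
  move=> km tT Dy; rewrite (le_trans (Dvb k m t y km tT Dy))// polB// lerDl ltW//.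
have bB y i : D y -> `|mu y 0 i| <= B * weight y ^+ K.
  move=> Dy; rewrite (le_trans (normr_coord_enorm _ _))//.
  by rewrite (le_trans (mub y Dy))// polB// lerDr ltW.
have uB t y : 0 <= t <= T -> D y -> `|u t y| <= B * weight y ^+ K.
  by move=> tT Dy; apply: (derivs_growth dDv DvB hT (cut y Dy)).
pose m := Num.bound (p / (p - 1)).
have pm : p / (p - 1) <= m%:R.
  by rewrite ltW// archi_boundP// divr_ge0// ?subr_ge0 ltW// (lt_trans ltr01).
(* A sum that dominates the three exponents required by [one_step_bound]. *)
pose q := (3 * K + K * m + 2 * (K + 4))%N.
have q_gt1 : 1 < q%:R :> R.
  by rewrite ltr1n /q mulnDr addnA addnC.
have [Cq [Cq0 HCq]] := H2 q%:R q_gt1.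
have [C12 [C120 HC12]] := H2 12 ltac:(by rewrite ltr1n).
pose M : R := 2 ^+ q * (1 + d%:R ^+ q * (d%:R * Cq ^+ q)).
pose Nc : R := d%:R ^+ 12 * (d%:R * C12 ^+ 12).
pose S : R := B * (2 * M + 2 ^+ 12 * (1 + Nc))
  + (d%:R + d%:R ^+ 2 + d%:R ^+ 3) * (B * (M + c `^ p))
  + d%:R * (B ^+ 2 * M + T * (B * (M + c `^ p))).
(* [S] is the constant of [one_step_bound], independent of N; adding 1 to its absolute value makes
   the constant positive. *)
exists (Num.min hb1 hb2), (`|S| + 1); split.
- by rewrite lt_min hb10.
- by rewrite ltr_wpDl.
move=> N N0 h; rewrite lt_min => /andP[hh1 hh2].
have h0 : 0 < h by rewrite divr_gt0// ltr0n.
have NhT : N%:R * h = T by rewrite mulrC divfK// pnatr_eq0 -lt0n.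
have hT' : h <= T by rewrite ler_pdivrMr ?ltr0n// ler_peMr ?(ltW hT)// ler1n.
have [mX DX X0 _] := hX N N0.
have [H1a H1b] := H1 N N0 hh1.
have [H2a H2b] := HCq N N0 hh2.
have [_ H2d] := HC12 N N0 hh2.
pose t (n : nat) : R := n%:R * h.
have t_ge0 n : 0 <= t n by rewrite mulr_ge0// ltW.
have t_leT n : (n <= N)%N -> t n <= T.
  by move=> nN; rewrite -NhT ler_wpM2r ?(ltW h0)// ler_nat.
have tS n : t n.+1 - t n = h by rewrite /t -[n.+1]addn1 natrD; ring.
pose e n := \int[PX N]_w u (t n) (X N n w).
have wM n : (n <= N)%N -> Ebd (PX N) (fun w => weight (X N n w) ^+ q) M.
  move=> nN; apply: (weight_moment hd (mX n nN)) => i.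
  apply: Lp_le_vec_coord_nat (H2a n nN) => //; last exact: ltW.
  by rewrite -(ltr0n R) (lt_trans ltr01).
have mu_t n : (n <= N)%N -> measurable_fun setT (fun w => u (t n) (X N n w)).
  move=> nN; apply: (measurable_comp_within (mX n nN) (cuD (t n) _)).
    by rewrite t_ge0 t_leT.
  by move=> w; exact: DX.
have step n : (n < N)%N -> `|e n.+1 - e n| <= S * h ^+ 2.
  move=> nN; have nN' := ltnW nN.
  have ttn : t n < t n.+1 <= T by rewrite t_leT// andbT -subr_gt0 tS.
  (* Strictly before T, so the derivatives of u exist at t_n even when t_(n+1) = T. *)
  have tT : 0 <= t n < T by case/andP: ttn => a1 a2; rewrite t_ge0 (lt_le_trans a1).
  have [ce1 ce2 ce3] := H1a n nN.
  have [fB gB jB] := H1b n nN'.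
  have mdX : random_vector (fun w => X N n.+1 w - X N n w).
    by have [] := H2d n nN.
  apply: (@one_step_bound R d _ _ (PX N) (X N n) (X N n.+1) D (mX n nN') (mX _ nN)
    (DX n ^~ nN') (sigma_gen_base (X N) n) (sigma_gen_base_measurable (mX n nN'))
    (@sigma_gen_coord _ _ _ _ (X N) n) (Dv 1%N m0 (t n)) (Dv 0%N ^~ (t n))
    (Dv 1%N ^~ (t n)) B K B0 _ _ _ _ _ _ mu (fh h) (diffusion_mx sigma) (gh h)
    (jh h) bB T h p c M Nc m q h0 hT' p1 (ltW c0) pm) => //.
  - by apply: (derivs_within dDv _ tT); rewrite mlen_m0.
  - by move=> k k3; apply: (derivs_within dDv _ tT); rewrite muln0 (leq_trans k3).
  - by move=> k k1; apply: (derivs_within dDv _ tT); rewrite (leq_add2l 2 _ 2) (leq_trans k1).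
  - by move=> y Dy; apply: DvB => //; rewrite mlen_m0.
  - by move=> k y k3 Dy; apply: DvB => //; rewrite muln0 (leq_trans k3).
  - by move=> k y k1 Dy; apply: DvB => //; rewrite (leq_add2l 2 _ 2) (leq_trans k1).
  - by rewrite /q -addnA leq_addr.
  - by rewrite /q addnAC leq_addl.
  - by rewrite /q leq_addl.
  - exact: wM.
  - exact: wM.
  (* The moment of order 12 carries sqrt h to the power 12, that is h^6. *)
  - have := norm1_moment hd mdX (fun i => Lp_le_vec_coord_nat i _ _ (H2d n nN)).
    move=> /(_ isT) /(_ (mulr_ge0 (ltW C120) (sqrtr_ge0 _))).
    rewrite exprMn -[Num.sqrt h ^+ 12]/(Num.sqrt h ^+ (2 * 6)) exprM.
    by rewrite sqr_sqrtr ?(ltW h0)// /Nc !mulrA.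
  - move=> i; split; first by case: fB.
    exact: Lp_le_vec_coord (lt_trans ltr01 p1) fB.
  - move=> i k; case: gB => mg gB; split; first exact: mg.
    apply: (Lnorm_Ebd (lt_trans ltr01 p1) (mg i k) _ gB) => w.
    exact: le_trans (normr_entry_opnorm _ _ _) (ler_norm _).
  - move=> k k3; have [mj jB'] := jB k k3; split => //.
    exact: (Lnorm_Ebd (lt_trans ltr01 p1) mj _ jB').
  - by move=> y Dy; apply: (classical_solution_derivs oA AD DA _ hpde dDv tT Dy).
  - exact: mu_t.
  - exact: mu_t.
  - by move=> w; apply: uB; [rewrite t_ge0 t_leT|exact: DX].
  - by move=> w; apply: uB; [rewrite t_ge0 t_leT|exact: DX].
  - move=> w; rewrite -(tS n).
    by apply: (derivs_step_expansion oA cA AD DA dDv B0 DvB) => //; exact: DX.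
(* The expectation in the claim is extended-valued; integrability identifies it with the real number
   [e N]. *)
have iN : integ (PX N) (fun w => u (t N) (X N N w)).
  apply: (integ_dom (mu_t N (leqnn N)) (integZ B (wM N (leqnn N)).1)) => w.
  apply: (@le_trans _ _ (B * weight (X N N w) ^+ K)).
    by apply: uB; [rewrite t_ge0 t_leT|exact: DX].
  rewrite ler_wpM2l// ler_weXn2l ?weight_ge1// /q -addnA (leq_trans _ (leq_addr _ _))//.
  by rewrite leq_pmull.
have eN : ('E_(PX N)[(fun w => f (X N N w))] = (e N)%:E)%E.
  rewrite unlock /e /Rintegral; have tN : t N = T by [].
  rewrite tN fineK.
    by apply: eq_integral => w _; rewrite uT//; exact: DX.
  by have := integrable_fin_num measurableT iN; rewrite /= tN.
have e0 : e 0%N = u 0 y0.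
  rewrite /e /t mul0r; under eq_Rintegral do rewrite X0.
  by rewrite Rintegral_cst//= probability_setT mulr1.
have eY : ('E_PY[(fun w => f (Y T w))] = (u 0 y0)%:E)%E.
  by apply: (hu 0 y0 _ hy0 _ _ _ _ _ _ hY); rewrite lexx ltW.
rewrite eN eY -e0 -EFinB lee_fin.
rewrite -(telescope_sumr e (leq0n N)) big_mkord.
rewrite (le_trans (ler_norm_sum _ _ _))//.
apply: (@le_trans _ _ (\sum_(i < N) (`|S| + 1) * h ^+ 2)).
  apply: ler_sum => i _; rewrite (le_trans (step i (ltn_ord i)))//.
  by rewrite ler_wpM2r ?exprn_ge0 ?(ltW h0)// (le_trans (ler_norm _))// lerDl.
(* N steps of size h^2 add up to N h^2 = T h. *)
rewrite sumr_const card_ord -mulr_natr -NhT le_eqVlt; apply/orP; left.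
by apply/eqP; ring.
Qed.
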